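(* (1) If for every $p$, $M$, $\prec$ witnessing that a function $f$ is in ${\rm CLU\#P_{circular}}$, the function $f$ is also in ${\rm CLU\#P}$ via some witness whose nondeterminism polynomial is exactly $p$, then ${\rm P}={\rm UP}$. (2) If for every $p$, $M$, $\prec$ witnessing that a function $f$ is in ${\rm CLU\#P_{free}}$, the function $f$ is also in ${\rm CLU\#P}$ via some witness whose nondeterminism polynomial is exactly $p$, then ${\rm P}={\rm UP}$. (3) If for every $p$, $M$, $\prec$ witnessing membership in ${\rm CLU\#P_{free}}$ the top function $x\mapsto \mathrm{top}(x)$ and bottom function $x\mapsto\mathrm{bot}(x)$ are in ${\rm UPSV_t}$, then ${\rm UP}={\rm coUP}$. (4) If for every $p$, $M$, $\prec$ witnessing membership in ${\rm CLU\#P_{free}}$ the top and bottom functions are in ${\rm FP}_{\rm t}$, then ${\rm P}={\rm UP}$.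
   Context: Alphabet $\Sigma=\{0,1\}$; NPTM = nondeterministic polynomial-time Turing machine. ${\rm UP}$: languages accepted by NPTMs with at most one accepting path on every input; ${\rm coUP}$: their complements. For a polynomial $p$, an NPTM $M$ is $p$-balanced if on every input $x$ its computation paths correspond exactly to the guess strings in $\{0,1\}^{p(|x|)}$; paths are identified with guess strings. $\mathrm{acc}_M(x)$ is the set of accepting paths, $\#\mathrm{acc}_M(x)$ its size. ${\rm FP}_{\rm t}$: total polynomial-time computable functions. For same-length strings, $a\prec_{\rm lex}b$ means $b$ is the immediate lexicographic successor of $a$; $\le_{\rm lex}$ is lexicographic order. ${\rm CLU\#P}$ (via nondeterminism polynomial $p$): total $f:\Sigma^*\to\mathbb{N}$ such that there exist a $p$-balanced NPTM $M$, $b,t\in{\rm FP}_{\rm t}$ and a polynomial-time 3-argument predicate $\prec$ such that for every $x$ there is a bijection $h_x$ of $\Sigma^{p(|x|)}$ with: $|b(x)|=|t(x)|=p(|x|)$; $h_x(b(x))=0^{p(|x|)}$, $h_x(t(x))=1^{p(|x|)}$; (adjacency) for $y,z\in\{0,1\}^{p(|x|)}$, $\prec(x,y,z)$ iff $h_x(y)\prec_{\rm lex}h_x(z)$; (cluster) if $f(x)\neq0$ there exist $\ell,u$ with $\mathrm{acc}_M(x)=\{w\in\{0,1\}^{p(|x|)}: h_x(\ell)\le_{\rm lex}h_x(w)\le_{\rm lex}h_x(u)\}$; $f(x)=\#\mathrm{acc}_M(x)$. A triple $p,M,\prec$ witnesses $f\in{\rm CLU\#P_{free}}$ if $M$ is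 $p$-balanced, $\prec$ polynomial-time, and for every $x$ there is a bijection $h_x$ satisfying the adjacency, cluster and counting conditions above (no $b,t$). It witnesses $f\in{\rm CLU\#P_{circular}}$ if the same holds but with adjacency condition: $\prec(x,y,z)$ iff $h_x(y)\prec_{\rm lex}h_x(z)$ or ($h_x(y)=1^{p(|x|)}$ and $h_x(z)=0^{p(|x|)}$). For a ${\rm CLU\#P_{free}}$ witness $p,M,\prec$, the top function maps $x$ to $h_x^{-1}(1^{p(|x|)})$ (the unique $y\in\{0,1\}^{p(|x|)}$ with no $z$ satisfying $\prec(x,y,z)$) and the bottom function maps $x$ to $h_x^{-1}(0^{p(|x|)})$. ${\rm UPSV_p}$: partial functions $g$ for which there is an NPTM that on every input has at most one accepting path, has an accepting path exactly on the domain of $g$, and outputs $g(x)$ on that path. ${\rm UPSV_t}$: the total functions in ${\rm UPSV_p}$. *)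

(* Defs.v *)
From HB Require Import structures.
From mathcomp Require Import all_boot all_order all_fingroup all_algebra.
From mathcomp Require Import boolp classical_sets.

Set Implicit Arguments.
Unset Strict Implicit.
Unset Printing Implicit Defensive.

Import Order.TTheory GRing.Theory.

(* Nondeterministic multi-tape Turing machines.  Tapes are two-way infinite;   *)
(* a letter is the blank [None], an input bit, or an auxiliary letter of [E].  *)

Definition letter (E : Type) : Type := option (bool + E).

Definition bit_letter (E : Type) (b : bool) : letter E := Some (inl b).

(* [lcells] lists the cells to the left of the head, nearest first, and        *)
(* [rcells] those to its right; all cells beyond the two lists are blank.      *)
Record tape (E : Type) := Tape {
  lcells : seq (letter E);
  scanned : letter E;
  rcells : seq (letter E)
}.

Inductive move := MoveLeft | MoveRight | Stay.

Definition write_move (E : Type) (a : letter E) (m : move) (t : tape E) :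
    tape E :=
  match m with
  | MoveLeft => Tape (behead (lcells t)) (head None (lcells t)) (a :: rcells t)
  | MoveRight => Tape (a :: lcells t) (head None (rcells t)) (behead (rcells t))
  | Stay => Tape (lcells t) a (rcells t)
  end.

(* The head starts on the first bit of the word. *)
Definition input_tape (E : Type) (s : seq bool) : tape E :=
  let s' := [seq bit_letter E b | b <- s] in
  Tape [::] (head None s') (behead s').

Fixpoint leading_bits (E : Type) (s : seq (letter E)) : seq bool :=
  if s is Some (inl b) :: s' then b :: leading_bits s' else [::].

(* The word written on a tape: the maximal block of bits that starts at the    *)
(* head and extends to the right.                                              *)
Definition tape_word (E : Type) (t : tape E) : seq bool :=
  leading_bits (scanned t :: rcells t).

Inductive instr (A : Type) :=
  | Halt
  | Step of A
  | Guess of bool -> A.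
Arguments Halt {A}.

Record machine := Machine {
  ntapes : nat;                             (* the tapes are 'I_ntapes.+1 *)
  state : finType;
  aux : finType;
  start : state;
  accepting : pred state;
  delta : state -> {ffun 'I_ntapes.+1 -> letter aux} ->
    instr (state * {ffun 'I_ntapes.+1 -> letter aux * move})
}.

Record config (M : machine) := Config {
  cstate : state M;
  ctapes : {ffun 'I_(ntapes M).+1 -> tape (aux M)}
}.

Definition current_instr (M : machine) (c : config M) :=
  delta (cstate c) [ffun i => scanned (ctapes c i)].

Definition perform (M : machine)
    (a : state M * {ffun 'I_(ntapes M).+1 -> letter (aux M) * move})
    (c : config M) : config M :=
  Config a.1 [ffun i => write_move (a.2 i).1 (a.2 i).2 (ctapes c i)].

(* The i-th argument is written on tape i; all other tapes are blank. *)
Definition init (M : machine) (args : seq (seq bool)) : config M :=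
  Config (start M) [ffun i : 'I_(ntapes M).+1 =>
                      input_tape (aux M) (nth [::] args i)].

Definition halted (M : machine) (c : config M) : Prop := current_instr c = Halt.

Definition output (M : machine) (c : config M) : seq bool :=
  tape_word (ctapes c ord_max).

(* [run c n g d]: some n consecutive steps lead from c to d, and g is the      *)
(* sequence of guesses made on the way.                                        *)
Inductive run (M : machine) : config M -> nat -> seq bool -> config M -> Prop :=
  | run_refl c : run c 0 [::] c
  | run_step c a n g d : current_instr c = Step a ->
      run (perform a c) n g d -> run c n.+1 g d
  | run_guess c a b n g d : current_instr c = Guess a ->
      run (perform (a b) c) n g d -> run c n.+1 (b :: g) d.

(* The computation path with guess string g on the given arguments exists      *)
(* and halts in the configuration d.                                           *)
Definition path_to (M : machine) (args : seq (seq bool)) (g : seq bool)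
    (d : config M) : Prop :=
  (exists n, run (init M args) n g d) /\ halted d.

Definition is_path (M : machine) (args : seq (seq bool)) (g : seq bool) : Prop :=
  exists d : config M, path_to args g d.

Definition accepting_path (M : machine) (args : seq (seq bool)) (g : seq bool) :
    Prop :=
  exists2 d : config M, path_to args g d & accepting (cstate d).

(* Every partial computation is bounded, hence every path halts. *)
Definition polytime (M : machine) (arity : nat) : Prop :=
  exists q : {poly nat}, forall args : seq (seq bool), size args = arity ->
    forall n g (d : config M), run (init M args) n g d ->
      n <= q.[sumn (map size args)]%R.

Definition deterministic (M : machine) : Prop :=
  forall q s a, @delta M q s <> Guess a.

Definition NPTM (M : machine) : Prop := polytime M 1.

Definition at_most_one_accepting_path (M : machine) : Prop :=
  forall x g g', accepting_path M [:: x] g -> accepting_path M [:: x] g' ->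
    g = g'.

Definition language := set (seq bool).

Definition classP : set language := fun L =>
  exists M, [/\ deterministic M, polytime M 1 &
    forall x, L x <-> accepting_path M [:: x] [::]].

Definition classUP : set language := fun L =>
  exists M, [/\ NPTM M, at_most_one_accepting_path M &
    forall x, L x <-> exists g, accepting_path M [:: x] g].

Definition classcoUP : set language := fun L => classUP (~` L)%classic.

Definition polytime_pred3 (R : seq bool -> seq bool -> seq bool -> Prop) :
    Prop :=
  exists M, [/\ deterministic M, polytime M 3 &
    forall x y z, R x y z <-> accepting_path M [:: x; y; z] [::]].

Definition FPt (f : seq bool -> seq bool) : Prop :=
  exists M, [/\ deterministic M, polytime M 1 &
    forall x, exists2 d : config M, path_to [:: x] [::] d & output d = f x].

Definition UPSVp (g : seq bool -> option (seq bool)) : Prop :=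
  exists M, [/\ NPTM M, at_most_one_accepting_path M,
    forall x, (exists y, accepting_path M [:: x] y) <-> g x <> None &
    forall x y (d : config M), path_to [:: x] y d -> accepting (cstate d) ->
      g x = Some (output d)].

Definition UPSVt (g : seq bool -> seq bool) : Prop :=
  UPSVp (fun x => Some (g x)).

Definition balanced (p : {poly nat}) (M : machine) : Prop :=
  forall x g, is_path M [:: x] g <-> size g = p.[size x]%R.

Definition acc (p : {poly nat}) (M : machine) (x : seq bool) :
    {set (p.[size x]%R).-tuple bool} :=
  [set w : (p.[size x]%R).-tuple bool | `[< accepting_path M [:: x] w >]]%SET.

Definition zeros (n : nat) : n.-tuple bool := nseq_tuple n false.
Definition ones (n : nat) : n.-tuple bool := nseq_tuple n true.

Definition lex_le (n : nat) (a b : n.-tuple bool) : bool :=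
  ((a : n.-tuplelexi bool) <= b)%O.

Definition lex_lt (n : nat) (a b : n.-tuple bool) : bool :=
  ((a : n.-tuplelexi bool) < b)%O.

Definition lex_succ (n : nat) (a b : n.-tuple bool) : Prop :=
  lex_lt a b /\ forall c, ~ (lex_lt a c /\ lex_lt c b).

Definition bijections (p : {poly nat}) : Type :=
  forall x : seq bool, {perm (p.[size x]%R).-tuple bool}.

Definition adjacency (p : {poly nat}) (h : bijections p)
    (prec : seq bool -> seq bool -> seq bool -> Prop) : Prop :=
  forall x (y z : (p.[size x]%R).-tuple bool),
    prec x y z <-> lex_succ (h x y) (h x z).

Definition circular_adjacency (p : {poly nat}) (h : bijections p)
    (prec : seq bool -> seq bool -> seq bool -> Prop) : Prop :=
  forall x (y z : (p.[size x]%R).-tuple bool),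
    prec x y z <-> lex_succ (h x y) (h x z) \/
                   (h x y = ones _ /\ h x z = zeros _).

Definition cluster (p : {poly nat}) (h : bijections p) (M : machine)
    (f : seq bool -> nat) : Prop :=
  forall x, f x <> 0 -> exists l u : (p.[size x]%R).-tuple bool,
    acc p M x = [set w | lex_le (h x l) (h x w) && lex_le (h x w) (h x u)]%SET.

Definition counting (p : {poly nat}) (M : machine) (f : seq bool -> nat) :
    Prop :=
  forall x, f x = #|acc p M x|.

(* Membership in CLU#P via the nondeterminism polynomial p *)
Definition CLU (p : {poly nat}) (f : seq bool -> nat) : Prop :=
  exists M b t prec (h : bijections p),
    [/\ NPTM M /\ balanced p M,
        [/\ FPt b, FPt t & polytime_pred3 prec],
        forall x,
          (exists2 y : (p.[size x]%R).-tuple bool,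
             tval y = b x & h x y = zeros _) /\
          (exists2 y : (p.[size x]%R).-tuple bool,
             tval y = t x & h x y = ones _),
        adjacency h prec &
        cluster h M f /\ counting p M f].

Definition CLUfree_with (p : {poly nat}) (M : machine)
    (prec : seq bool -> seq bool -> seq bool -> Prop) (f : seq bool -> nat)
    (h : bijections p) : Prop :=
  [/\ NPTM M /\ balanced p M, polytime_pred3 prec, adjacency h prec,
      cluster h M f & counting p M f].

Definition CLUfree_witness (p : {poly nat}) (M : machine)
    (prec : seq bool -> seq bool -> seq bool -> Prop) (f : seq bool -> nat) :
    Prop :=
  exists h : bijections p, CLUfree_with M prec f h.

Definition CLUcircular_witness (p : {poly nat}) (M : machine)
    (prec : seq bool -> seq bool -> seq bool -> Prop) (f : seq bool -> nat) :
    Prop :=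
  exists h : bijections p,
    [/\ NPTM M /\ balanced p M, polytime_pred3 prec, circular_adjacency h prec,
        cluster h M f & counting p M f].

Definition top_fun (p : {poly nat}) (h : bijections p) (x : seq bool) : seq bool :=
  (h x)^-1%g (ones _).

Definition bot_fun (p : {poly nat}) (h : bijections p) (x : seq bool) : seq bool :=
  (h x)^-1%g (zeros _).

(* Main.v *)
Require Import Defs.
From mathcomp Require Import all_boot all_order all_fingroup all_algebra.
From mathcomp Require Import boolp classical_sets.
From mathcomp Require Import zify.

(* Let N be a UP machine for L running in time q, and p = q + 1.  Pad every    *)
(* accepting guess string of N with zeros to length q(|x|): at most one padded *)
(* witness w remains, and it exists iff x is in L.  Let M guess u of length    *)
(* p(|x|) and reject exactly if u = 0w.  Order the strings a y by the number   *)
(* 2y + a.  Moving 0w to the end of this order (free case) keeps adjacency     *)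
(* decidable by a single replay of N on z, because 0z, its neighbours 1(z - 1) *)
(* and 1z, and the former last string 11...1 are the only places that change;  *)
(* rotating the order until 0w is last (circular case) does not change cyclic  *)
(* adjacency at all.  In both cases M accepts an initial segment whose only    *)
(* missing element, if any, is the top.  Hence x is in L iff M rejects the     *)
(* path top(x), which gives (3) and (4).  For (1) and (2), a CLU#P machine M'  *)
(* for the same f accepts all paths or all but one, in which case the missing  *)
(* one is an end of its order; so x is not in L iff M' accepts b(x) and t(x).  *)

Set Implicit Arguments.
Unset Strict Implicit.
Unset Printing Implicit Defensive.

Import Order.TTheory GRing.Theory.

(** * Runs and tapes *)

(** All four implications are attacked with one instance, [UP_instance], built from an arbitrary UP
    language [L]: a balanced machine [M] that accepts every path when [x] is outside [L] and all
    paths but one when [x] is in [L], together with two orders that put the rejected path last. The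
    accepting paths form an interval ([hard_cluster]), and [L] is encoded in whether [M] accepts the
    top ([hard_top]): adjacency is easy, locating the top is as hard as deciding [L]. The orders
    come from [free_order] and [circ_order]; their adjacency is decided by a finite automaton, in
    the free case after one replay of the UP machine ([circ_prec_polytime], [free_prec_polytime]).

    If the top is computable, deterministically or unambiguously, [M] is evaluated on it. If instead
    the function lies in CLU#P with the same [p], then [CLU_classP] applies: an interval containing
    both ends of an order is everything, so evaluating the new machine at its two known ends decides
    [L].

    The rest is machine building. Program fragments are composed under the relation [exec] and
    turned into machines by [compile]. [exec_simf] replays a machine on a recorded guess string,
    [guided] chains one machine with such a replay of another and yields every closure property
    used, and [balanced_machine] guesses exactly p(|x|) bits. Uniqueness throughout rests on the
    prefix-freeness of halting guess strings, [trun_halt_unique]. *)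

Definition imap (A B : Type) (f : A -> B) (i : instr A) : instr B :=
  match i with
  | Halt => Halt
  | Step a => Step (f a)
  | Guess a => Guess (fun b => f (a b))
  end.

Section Runs.
Variables (C : Type) (ins : C -> instr C).

Inductive trun : C -> nat -> seq bool -> C -> Prop :=
  | trun_refl c : trun c 0 [::] c
  | trun_step c c' n g d : ins c = Step c' -> trun c' n g d -> trun c n.+1 g d
  | trun_guess c a b n g d :
      ins c = Guess a -> trun (a b) n g d -> trun c n.+1 (b :: g) d.

Lemma trun_cat c n g d n' g' d' :
  trun c n g d -> trun d n' g' d' -> trun c (n + n') (g ++ g') d'.
Proof.
elim=> [//|{}c c1 {}n {}g {}d e _ IH|{}c a b {}n {}g {}d e _ IH] r /=.
  by rewrite addSn; apply: trun_step e (IH r).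
by rewrite addSn; apply: trun_guess e (IH r).
Qed.

Lemma trun_size c n g d : trun c n g d -> size g <= n.
Proof. by elim=> //= {}c c1 {}n {}g {}d _ _ /leqW. Qed.

Lemma trun_halt c n g d : ins c = Halt -> trun c n g d ->
  [/\ n = 0, g = [::] & d = c].
Proof. by move=> h r; case: r h => // [c1 ? ? ? ? ->|c1 ? ? ? ? ? ->]. Qed.

(** Between guesses a run is forced. The tails [r] and [r'] are arbitrary, so the equation only says
    that one guess string is a prefix of the other. *)
Lemma trun_prefix c n g d n' g' d' r r' :
    trun c n g d -> trun c n' g' d' -> n <= n' -> g ++ r = g' ++ r' ->
  exists2 g2, g' = g ++ g2 & trun d (n' - n) g2 d'.
Proof.
move=> H; elim: H n' g' => [{}c|{}c c1 {}n {}g {}d e _ IH|{}c a b {}n {}g {}d e _ IH].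
- by move=> n' g' h _ _; exists g'; rewrite ?subn0.
- move=> n' g' h; case: h e IH => [//|{}c c2 m g2 d2 e2 h|{}c a2 b2 m g2 d2 e2 h].
    rewrite e2 => -[<-] IH lemn eg; rewrite subSS; exact: IH eg.
  by rewrite e2.
- move=> n' g' h; case: h e IH => [//|{}c c2 m g2 d2 e2 h|{}c a2 b2 m g2 d2 e2 h].
    by rewrite e2.
  rewrite e2 => -[<-] IH lemn /= [eb eg]; rewrite subSS -eb in h *.
  by case: (IH _ _ h lemn eg) => g3 -> h3; exists g3.
Qed.

(** The shorter run is an initial part of the longer one and cannot be continued once halted; hence
    halting guess strings are prefix-free. *)
Lemma trun_halt_unique c n g d n' g' d' r r' :
    trun c n g d -> ins d = Halt -> trun c n' g' d' -> ins d' = Halt ->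
    g ++ r = g' ++ r' ->
  [/\ n = n', g = g' & d = d'].
Proof.
wlog lenn : n g d n' g' d' r r' / n <= n' => [W R h R' h' e|R h R' h' e].
  case/orP: (leq_total n n') => le1; first exact: W e.
  by case: (W _ _ _ _ _ _ _ _ le1 R' h' R h (esym e)).
case: (trun_prefix R R' lenn e) => g2 -> /(trun_halt h) [en -> ->].
by rewrite cats0; split=> //; lia.
Qed.

(** Feed [y] to the guesses: the time bound excludes an endless run, so it halts on a prefix of [y]
    or gets stuck asking for a bit beyond [y]. *)
Lemma trun_progress B c y :
    (forall n g d, trun c n g d -> n <= B) ->
  (exists k n d, [/\ k <= size y, trun c n (take k y) d & ins d = Halt]) \/
  (exists n d a, trun c n y d /\ ins d = Guess a).
Proof.
elim: B c y => [|B IH] c y bnd; case e: (ins c) => [|c'|a].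
- by left; exists 0, 0, c; rewrite take0; split=> //; apply: trun_refl.
- by have := bnd _ _ _ (trun_step e (trun_refl c')).
- by have := bnd _ _ _ (trun_guess e (trun_refl (a true))).
- by left; exists 0, 0, c; rewrite take0; split=> //; apply: trun_refl.
- case: (IH c' y) => [n g d /(trun_step e) /bnd //| |].
    by case=> k [n [d [? /(trun_step e) ? ?]]]; left; exists k, n.+1, d.
  by case=> n [d [a [/(trun_step e) ? ?]]]; right; exists n.+1, d, a.
- case: y => [|b y]; first by right; exists 0, c, a; split=> //; apply: trun_refl.
  case: (IH (a b) y) => [n g d /(trun_guess e) /bnd //| |].
    case=> k [n [d [? /(trun_guess e) ? ?]]]; left; exists k.+1, n.+1, d.
    by split.
  by case=> n [d [a' [/(trun_guess e) ? ?]]]; right; exists n.+1, d, a'.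
Qed.

End Runs.

(** Halting configurations are exempt from the hypothesis because a halted component of a larger
    program hands over control instead of halting. *)
Lemma trun_map (C D : Type) (insC : C -> instr C) (insD : D -> instr D)
    (phi : C -> D) c n g d :
    (forall c, insC c <> Halt -> insD (phi c) = imap phi (insC c)) ->
  trun insC c n g d -> trun insD (phi c) n g (phi d).
Proof.
move=> H; elim=> [{}c|{}c c1 {}n {}g {}d e _ IH|{}c a b {}n {}g {}d e _ IH].
- exact: trun_refl.
- by apply: trun_step IH; rewrite H e.
- by apply: (trun_guess (a := fun b => phi (a b)) _ IH); rewrite H e.
Qed.

Lemma trun_unmap (C D : Type) (insC : C -> instr C) (insD : D -> instr D)
    (phi : C -> D) c n g d' :
    (forall c, insD (phi c) = imap phi (insC c)) ->
    trun insD (phi c) n g d' ->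
  exists2 d, d' = phi d & trun insC c n g d.
Proof.
move=> H; move ec: (phi c) => c' h.
elim: h c ec => [{}c'|{}c' c1 {}n {}g {}d' e _ IH|{}c' a b {}n {}g {}d' e _ IH] c ec.
- by exists c => //; apply: trun_refl.
- move: e; rewrite -ec H; case e: (insC c) => //= -[/IH [d -> ?]].
  by exists d => //; apply: trun_step e _.
- move: e; rewrite -ec H; case e: (insC c) => [|//|a'] //= -[ea].
  case: (IH (a' b)) => [|d -> ?]; first by rewrite -ea.
  by exists d => //; apply: trun_guess e _.
Qed.

Definition mins (M : machine) (c : config M) : instr (config M) :=
  imap (fun a => perform a c) (current_instr c).

Lemma runE (M : machine) (c d : config M) n g :
  run c n g d <-> trun (@mins M) c n g d.
Proof.
split; elim=> {c n g d} [c|c c1 n g d e _ IH|c a b n g d e _ IH].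
- exact: trun_refl.
- by apply: trun_step IH; rewrite /mins e.
- by apply: (trun_guess (a := fun b => perform (a b) c) _ IH); rewrite /mins e.
- exact: run_refl.
- move: e; rewrite /mins; case e: (current_instr c) => //= -[ec].
  by apply: run_step e _; rewrite ec.
- move: e; rewrite /mins; case e: (current_instr c) => //= -[ec].
  by apply: run_guess e _; move: IH; rewrite -ec.
Qed.

Lemma haltedE (M : machine) (c : config M) : halted c <-> mins c = Halt.
Proof. by rewrite /halted /mins; case: (current_instr c). Qed.

Lemma path_to_unique (M : machine) args g d g' d' r r' :
    @path_to M args g d -> path_to args g' d' -> g ++ r = g' ++ r' ->
  g = g' /\ d = d'.
Proof.
case=> -[n /runE R] /haltedE h [[n' /runE R'] /haltedE h'] e.
by case: (trun_halt_unique R h R' h' e).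
Qed.

(* Tapes are modelled as functions whose head is always at position 0, so that *)
(* tapes differing only in the number of explicit blanks become equal.         *)
Definition tp (E : Type) := int -> letter E.

Definition off (m : move) : int :=
  match m with MoveLeft => (- 1)%R | MoveRight => 1%R | Stay => 0%R end.

(** The tape moves under a fixed head: cell [i] afterwards is cell [i + off m] before, and the old
    position 0 is the one overwritten. *)
Definition twm (E : Type) (am : letter E * move) (t : tp E) : tp E :=
  fun i => if (i + off am.2)%R == 0%R then am.1 else t (i + off am.2)%R.

Definition den (E : Type) (t : tape E) : tp E := fun i =>
  match i with
  | Posz 0 => scanned t
  | Posz n.+1 => nth None (rcells t) n
  | Negz n => nth None (lcells t) n
  end.

Definition inp (E : Type) (s : seq bool) : tp E := fun i =>
  if i is Posz n then nth None [seq bit_letter E b | b <- s] n else None.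

Definition shift (E : Type) (t : tp E) (k : int) : tp E := fun i => t (i + k)%R.

Lemma den_write_move (E : Type) a m (t : tape E) :
  den (write_move a m t) = twm (a, m) (den t).
Proof.
case: t => l s r; apply: funext => i; rewrite /twm [(a, m).1]/= [(a, m).2]/=.
case: m; rewrite [off _]/=.
- case: i => [[|[|n]]|n].
  + by rewrite /= nth0.
  + by [].
  + by rewrite (_ : (Posz n.+2 + -1)%R = Posz n.+1) //; lia.
  + by rewrite (_ : (Negz n + -1)%R = Negz n.+1) /= ?nth_behead //; lia.
- case: i => [[|n]|[|n]].
  + by rewrite /= nth0.
  + by rewrite (_ : (Posz n.+1 + 1)%R = Posz n.+2) /= ?nth_behead //; lia.
  + by [].
  + by rewrite (_ : (Negz n.+1 + 1)%R = Negz n) //; lia.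
- by rewrite addr0; case: i => [[|n]|n].
Qed.

Lemma den_input_tape (E : Type) s : den (input_tape E s) = inp E s.
Proof.
apply: funext => -[[|n]|n]; rewrite /den /input_tape /inp.
- by case: s.
- by rewrite nth_behead.
- by rewrite nth_nil.
Qed.

Lemma shift0 (E : Type) (t : tp E) : shift t 0%R = t.
Proof. by apply: funext => i; rewrite /shift addr0. Qed.

Lemma shift_shift (E : Type) (t : tp E) k l :
  shift (shift t k) l = shift t (k + l)%R.
Proof. by apply: funext => i; rewrite /shift -addrA (addrC l). Qed.

Lemma twm_keep (E : Type) (t : tp E) m : twm (t 0%R, m) t = shift t (off m).
Proof.
by apply: funext => i; rewrite /twm /shift /=; case: eqP => [->|].
Qed.

Lemma twm_write (E : Type) (u : seq bool) (b : bool) :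
  twm (bit_letter E b, MoveRight) (shift (inp E u) (Posz (size u))) =
  shift (inp E (rcons u b)) (Posz (size u).+1).
Proof.
apply: funext => i; rewrite /twm /shift /=.
have -> : (i + 1 + Posz (size u) = i + Posz (size u).+1)%R by lia.
case: eqP => [e|ne].
  have -> : (i + Posz (size u).+1)%R = Posz (size u) by lia.
  by rewrite /= map_rcons nth_rcons size_map ltnn eqxx.
case e: (i + _)%R => [n|n] //=; rewrite map_rcons nth_rcons size_map.
case: ltngtP => // [ltn|]; last by lia.
by rewrite nth_default // size_map ltnW.
Qed.

(** * Program fragments *)

(* A program fragment is a machine whose tapes are indexed by an arbitrary     *)
(* finite type; it returns the boolean [facc s] by halting in state [s].       *)
Record frag (I : finType) (E : Type) := Frag {
  fstate : finType;
  fentry : fstate;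
  facc : pred fstate;
  fdelta : fstate -> (I -> letter E) -> instr (fstate * (I -> letter E * move))
}.

Section Fragments.
Variables (I : finType) (E : Type).
Implicit Types (A B : frag I E) (T : I -> tp E) (L : I -> letter E).

Definition fins A (c : fstate A * (I -> tp E)) : instr (fstate A * (I -> tp E)) :=
  imap (fun a => (a.1, fun i => twm (a.2 i) (c.2 i)))
       (fdelta c.1 (fun i => c.2 i 0%R)).

(** A total-correctness triple with verdict [b]: [N] is only an upper bound on the steps, while [g]
    is exactly the sequence of guesses consumed. *)
Definition exec A T (N : nat) (g : seq bool) T' (b : bool) : Prop :=
  exists n s, [/\ n <= N, trun (@fins A) (fentry A, T) n g (s, T'),
                  fins (s, T') = Halt & facc s = b].

Definition fdet A : Prop := forall s L a, @fdelta I E A s L <> Guess a.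

Lemma exec_leq A T N N' g T' b :
  N <= N' -> exec A T N g T' b -> exec A T N' g T' b.
Proof.
by move=> le [n [s [len R h e]]]; exists n, s; split=> //; apply: leq_trans le.
Qed.

Lemma exec_unique A T N g T1 b N' g' T2 b' r r' :
    exec A T N g T1 b -> exec A T N' g' T2 b' -> g ++ r = g' ++ r' ->
  [/\ g = g', T1 = T2 & b = b'].
Proof.
case=> n [s [_ R h <-]] [n' [s' [_ R' h' <-]]] e.
by case: (trun_halt_unique R h R' h' e) => _ -> [-> ->].
Qed.

Definition upd T (i : I) (t : tp E) : I -> tp E :=
  fun k => if k == i then t else T k.

Lemma updE T i t : upd T i t i = t.
Proof. by rewrite /upd eqxx. Qed.

Lemma updN T i t k : k != i -> upd T i t k = T k.
Proof. by rewrite /upd => /negPf ->. Qed.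

Lemma upd_id T i : upd T i (T i) = T.
Proof. by apply: funext => k; rewrite /upd; case: eqP => // ->. Qed.

Lemma upd_upd T i t t' : upd (upd T i t) i t' = upd T i t'.
Proof. by apply: funext => k; rewrite /upd; case: eqP. Qed.

Lemma updC T i t j t' : i != j -> upd (upd T i t) j t' = upd (upd T j t') i t.
Proof.
move=> ij; apply: funext => k; rewrite /upd; case: (k =P j) => // ->.
by rewrite eq_sym (negPf ij).
Qed.

Definition keep L : I -> letter E * move := fun i => (L i, Stay).

Lemma twm_stay T : (fun i => twm (T i 0%R, Stay) (T i)) = T.
Proof. by apply: funext => i; rewrite twm_keep shift0. Qed.

Definition branch A B C : frag I E :=
  @Frag I E (fstate A + (fstate B + fstate C))%type (inl (fentry A))
    (fun s => match s with
      | inl _ => false | inr (inl s) => facc s | inr (inr s) => facc s end)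
    (fun s L => match s with
      | inl s =>
          match fdelta s L with
          | Halt => Step (inr (if facc s then inl (fentry B)
                               else inr (fentry C)), keep L)
          | Step a => Step (inl a.1, a.2)
          | Guess a => Guess (fun b => (inl (a b).1, (a b).2))
          end
      | inr (inl s) => imap (fun a => (inr (inl a.1), a.2)) (fdelta s L)
      | inr (inr s) => imap (fun a => (inr (inr a.1), a.2)) (fdelta s L)
      end).

Lemma exec_branch A B C T N g T1 b N' g' T2 b' :
    exec A T N g T1 b -> exec (if b then B else C) T1 N' g' T2 b' ->
  exec (branch A B C) T (N + N').+1 (g ++ g') T2 b'.
Proof.
case=> n [s [len R h es]].
have R1 : trun (@fins (branch A B C)) (inl (fentry A), T) n g (inl s, T1).
  apply: (trun_map (phi := fun c => (inl c.1, c.2)) _ R) => -[r U].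
  by rewrite /fins /=; case: (fdelta r).
(* [lft] abstracts the embedding of the chosen branch, so that both outcomes of the condition share
   one argument. *)
have e1 D (lft : fstate D -> fstate (branch A B C)) :
    (if facc s then inr (inl (fentry B)) else inr (inr (fentry C))) =
      lft (fentry D) ->
    (forall r L, fdelta (lft r) L = imap (fun a => (lft a.1, a.2)) (fdelta r L)) ->
    (forall r, facc (lft r) = facc r) ->
    exec D T1 N' g' T2 b' -> exec (branch A B C) T (N + N').+1 (g ++ g') T2 b'.
  move=> lft0 lftd lfta [n' [s' [len' R' h' <-]]].
  have insl r U : fins (lft r, U) = imap (fun c => (lft c.1, c.2)) (fins (r, U)).
    by rewrite /fins [(lft r, U).1]/= lftd; case: (fdelta r).
  exists (n + n'.+1), (lft s'); split; first by lia.
  - apply: (trun_cat R1 (@trun_step _ _ _ (lft (fentry D), T1) _ _ _ _ _)).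
      move: h; rewrite /fins /=; case: (fdelta s) => //= _.
      by rewrite twm_stay -lft0; case: (facc s).
    by apply: (trun_map (phi := fun c => (lft c.1, c.2)) _ R') => -[r U] _; exact: insl.
  - by rewrite insl h'.
  - exact: lfta.
case: b es e1 => es e1.
  by apply: (e1 B (fun r => inr (inl r))) => //; rewrite es.
by apply: (e1 C (fun r => inr (inr r))) => //; rewrite es.
Qed.

Definition neg A : frag I E :=
  @Frag I E (fstate A) (fentry A) (fun s => ~~ facc s) (@fdelta _ _ A).

Lemma exec_neg A T N g T' b : exec A T N g T' b -> exec (neg A) T N g T' (~~ b).
Proof.
by case=> n [s [len R h <-]]; exists n, s; split=> //; apply: trun_map R => -[? ?] _;
  rewrite /fins /=; case: (fdelta _).
Qed.

Definition loop (c : pred (I -> letter E)) B : frag I E :=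
  @Frag I E (option (fstate B)) None (fun s => s == None)
    (fun s L => match s with
      | None => if c L then Step (Some (fentry B), keep L) else Halt
      | Some s =>
          match fdelta s L with
          | Halt => Step (None, keep L)
          | Step a => Step (Some a.1, a.2)
          | Guess a => Guess (fun b => (Some (a b).1, (a b).2))
          end
      end).

Lemma exec_loop_end (c : pred (I -> letter E)) B T :
  ~~ c (fun i => T i 0%R) -> exec (loop c B) T 0 [::] T true.
Proof.
move=> /negPf h; exists 0, None; split=> //; first exact: trun_refl.
by rewrite /fins /= h.
Qed.

Lemma exec_loop_step (c : pred (I -> letter E)) B T N g T1 b N' g' T2 :
    c (fun i => T i 0%R) -> exec B T N g T1 b ->
    exec (loop c B) T1 N' g' T2 true ->
  exec (loop c B) T (N + N').+2 (g ++ g') T2 true.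
Proof.
move=> h [n [s [len R hs _]]] [n' [s' [len' R' hs' es']]].
exists (n.+1 + n').+1, s'; split=> //; first by lia.
apply: (@trun_step _ _ _ (Some (fentry B), T)).
  by rewrite /fins /= h /= twm_stay.
rewrite addSnnS; apply: trun_cat.
  apply: (trun_map (phi := fun c => (Some c.1, c.2)) _ R) => -[r U] /=.
  by rewrite /fins /=; case: (fdelta r).
apply: trun_step R'; move: hs; rewrite /fins /=; case: (fdelta s) => //= _.
by rewrite twm_stay.
Qed.

(** Each round costs two steps beyond the body, one to enter it and one to leave it. *)
Lemma exec_loop_iter (c : pred (I -> letter E)) B (Tk : nat -> I -> tp E) N k :
    (forall j, j < k -> c (fun i => Tk j i 0%R) /\
       exists b, exec B (Tk j) N [::] (Tk j.+1) b) ->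
    ~~ c (fun i => Tk k i 0%R) ->
  exec (loop c B) (Tk 0) (k * N.+2) [::] (Tk k) true.
Proof.
elim: k Tk => [|k IH] Tk H h; first exact: exec_loop_end.
case: (H 0 isT) => c0 [b e0]; rewrite mulSn -[[::]]/([::] ++ [::]) !addSn.
apply: exec_loop_step c0 e0 _.
by apply: (IH (fun j => Tk j.+1)) => // j /(H j.+1).
Qed.

Definition one (i : I) (f : (I -> letter E) -> letter E * move) : frag I E :=
  @Frag I E bool false id
    (fun s L => if s then Halt
                else Step (true, fun k => if k == i then f L else (L k, Stay))).

Lemma exec_one i f T :
  exec (one i f) T 1 [::] (upd T i (twm (f (fun k => T k 0%R)) (T i))) true.
Proof.
exists 1, true; split=> //; apply: trun_step (trun_refl _ _).
rewrite /fins /=; congr (Step (_, _)); apply: funext => k; rewrite /upd.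
by case: eqP => [->//|_]; rewrite twm_keep shift0.
Qed.

Definition guess_bit (i : I) : frag I E :=
  @Frag I E bool false id
    (fun s L => if s then Halt else Guess (fun b =>
       (true, fun k => if k == i then (bit_letter E b, MoveRight)
                       else (L k, Stay)))).

Lemma exec_guess_bit i T b :
  exec (guess_bit i) T 1 [:: b]
    (upd T i (twm (bit_letter E b, MoveRight) (T i))) true.
Proof.
exists 1, true; split=> //.
apply: (trun_guess (a := fun b =>
  (true, upd T i (twm (bit_letter E b, MoveRight) (T i))))) (trun_refl _ _).
rewrite /fins /=; congr Guess; apply: funext => c; congr (_, _).
apply: funext => k; rewrite /upd.
by case: eqP => [->//|_]; rewrite twm_keep shift0.
Qed.

Definition test (P : pred (I -> letter E)) : frag I E :=
  @Frag I E (option bool) None (pred1 (Some true))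
    (fun s L => if s is None then Step (Some (P L), keep L) else Halt).

Lemma exec_test P T : exec (test P) T 1 [::] T (P (fun k => T k 0%R)).
Proof.
exists 1, (Some (P (fun k => T k 0%R))); split=> //; last by case: (P _).
by apply: trun_step (trun_refl _ _); rewrite /fins /= twm_stay.
Qed.

Definition bitof (l : letter E) : option bool :=
  if l is Some (inl b) then Some b else None.

(** The cell behind [u] must not hold a bit, so [u] is the whole block starting at the head. *)
Fixpoint reads (t : tp E) (u : seq bool) : Prop :=
  if u is b :: u' then bitof (t 0%R) = Some b /\ reads (shift t 1%R) u'
  else bitof (t 0%R) = None.

(** The automaton reads two tapes in lockstep and stops when either word ends, just as [zip]
    truncates; the boolean marks the halted copy of each state. *)
Definition dfa (i j : I) (Q : finType) (d : Q -> bool -> bool -> Q) (q0 : Q)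
    (fin : pred Q) : frag I E :=
  @Frag I E (Q * bool)%type (q0, false) (fun s => fin s.1)
    (fun s L => if s.2 then Halt else
       match bitof (L i), bitof (L j) with
       | Some a, Some b =>
           Step ((d s.1 a b, false), fun k =>
                   (L k, if (k == i) || (k == j) then MoveRight else Stay))
       | _, _ => Step ((s.1, true), keep L)
       end).

Lemma exec_dfa i j (Q : finType) d (q0 : Q) fin T u v :
    reads (T i) u -> reads (T j) v ->
  exists2 T', exec (dfa i j d q0 fin) T (size u).+1 [::] T'
      (fin (foldl (fun q ab => d q ab.1 ab.2) q0 (zip u v))) &
    forall k, k != i -> k != j -> T' k = T k.
Proof.
move=> ru rv; set q1 := foldl _ _ _.
suff [T' [n [le R frame]]] : exists T' n, [/\ n <= (size u).+1,
    trun (@fins (dfa i j d q0 fin)) ((q0, false), T) n [::] ((q1, true), T') &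
    forall k, k != i -> k != j -> T' k = T k].
  by exists T' => //; exists n, (q1, true).
rewrite {}/q1; elim: u v q0 T ru rv => [|a u IH] [|b v] q T /=.
1-3: move=> ru rv; exists T, 1; split=> //; apply: trun_step (trun_refl _ _).
- by rewrite /fins /= ru /= twm_stay.
- by rewrite /fins /= ru /= twm_stay.
- by rewrite /fins /= rv; case: (bitof _) => *; rewrite /= twm_stay.
move=> [ea ru] [eb rv].
pose T1 k := twm (T k 0%R, if (k == i) || (k == j) then MoveRight else Stay) (T k).
case: (IH v (d q a b) T1) => [||T' [n [le R frame]]].
- by rewrite /T1 eqxx twm_keep.
- by rewrite /T1 eqxx orbT twm_keep.
exists T', n.+1; split=> //; first by apply: trun_step R; rewrite /fins /= ea eb.
move=> k ki kj; rewrite frame // /T1 (negPf ki) (negPf kj) twm_keep.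
exact: shift0.
Qed.

Definition seqf A B := branch A B B.

Lemma exec_seq A B T N g T1 b N' g' T2 b' :
    exec A T N g T1 b -> exec B T1 N' g' T2 b' ->
  exec (seqf A B) T (N + N').+1 (g ++ g') T2 b'.
Proof. by move=> e e'; apply: exec_branch e _; rewrite if_same. Qed.

Lemma fdet_branch A B C : fdet A -> fdet B -> fdet C -> fdet (branch A B C).
Proof.
move=> dA dB dC [s|[s|s]] L a /=; last 2 first.
- by case e: (fdelta s L) => [||a'] //= _; case: (dB _ _ _ e).
- by case e: (fdelta s L) => [||a'] //= _; case: (dC _ _ _ e).
by case e: (fdelta s L) => [||a'] //= _; case: (dA _ _ _ e).
Qed.

Lemma fdet_loop c B : fdet B -> fdet (loop c B).
Proof.
move=> dB [s|] L a /=; last by case: ifP.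
by case e: (fdelta s L) => [||a'] //= _; case: (dB _ _ _ e).
Qed.

Lemma fdet_one i f : fdet (one i f).
Proof. by case. Qed.

Lemma fdet_test P : fdet (test P).
Proof. by case. Qed.

Lemma fdet_dfa i j Q d q0 fin : fdet (@dfa i j Q d q0 fin).
Proof. by case=> q [] L a //=; case: bitof => // ?; case: bitof. Qed.

Definition isbit (i : I) : pred (I -> letter E) := fun L => bitof (L i) != None.

Definition shiftf (i : I) (m : move) := one i (fun L => (L i, m)).

Lemma exec_shiftf i m T :
  exec (shiftf i m) T 1 [::] (upd T i (shift (T i) (off m))) true.
Proof. by have := exec_one i (fun L => (L i, m)) T; rewrite twm_keep. Qed.

(* The initial left move makes this correct also when the head is just behind  *)
(* the word.                                                                   *)
Definition rewind (i : I) : frag I E :=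
  seqf (shiftf i MoveLeft)
    (seqf (loop (isbit i) (shiftf i MoveLeft)) (shiftf i MoveRight)).

Lemma bitof_inp u (k : nat) : bitof (inp E u (Posz k)) = nth None (map Some u) k.
Proof. by rewrite /=; elim: u k => [|b u IH] [|k] /=. Qed.

Lemma isbit_inp u (k : nat) : (bitof (inp E u (Posz k)) != None) = (k < size u).
Proof.
rewrite bitof_inp; case: (ltnP k (size u)) => h.
  by rewrite (nth_map true).
by rewrite nth_default ?size_map.
Qed.

Lemma exec_rewind i T u k : k <= size u -> T i = shift (inp E u) (Posz k) ->
  exec (rewind i) T (3 * k + 4) [::] (upd T i (inp E u)) true.
Proof.
move=> le eT.
(* The head position after the first left move and [j] rounds is [k - 1 - j]. The loop stops at
   position -1, on the blank left of the word, and the final right move corrects this. *)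
pose Tk j := upd T i (shift (inp E u) (Posz k - 1 - Posz j)%R).
have e1 : exec (shiftf i MoveLeft) T 1 [::] (Tk 0) true.
  by have := exec_shiftf i MoveLeft T; rewrite eT shift_shift /Tk subr0.
have e2 : exec (loop (isbit i) (shiftf i MoveLeft)) (Tk 0) (k * 3) [::] (Tk k) true.
  apply: exec_loop_iter => [j lt|]; last first.
    rewrite /isbit /Tk updE /shift.
    by rewrite (_ : (0 + _)%R = Negz 0) //; lia.
  split.
    rewrite /isbit /Tk updE /shift (_ : (0 + _)%R = Posz (k - j.+1)) ?isbit_inp; lia.
  exists true; have := exec_shiftf i MoveLeft (Tk j).
  rewrite {2 3}/Tk updE upd_upd shift_shift.
  by rewrite (_ : (_ + off _)%R = (Posz k - 1 - Posz j.+1)%R) //= ; lia.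
have e3 : exec (shiftf i MoveRight) (Tk k) 1 [::] (upd T i (inp E u)) true.
  have := exec_shiftf i MoveRight (Tk k).
  rewrite {2 3}/Tk updE upd_upd shift_shift.
  by rewrite (_ : (_ + off _)%R = 0%R) ?shift0 //=; lia.
have := exec_seq e1 (exec_seq e2 e3); apply: exec_leq; lia.
Qed.

Definition copy (i j : I) : frag I E :=
  seqf (loop (isbit i) (seqf (one j (fun L => (L i, MoveRight)))
                             (shiftf i MoveRight)))
       (seqf (rewind i) (rewind j)).

Lemma fdet_copy i j : fdet (copy i j).
Proof.
by do !(apply: fdet_branch || apply: fdet_loop || apply: fdet_one).
Qed.

Lemma exec_copy i j T u : i != j -> T i = inp E u -> T j = inp E [::] ->
  exec (copy i j) T (11 * size u + 10) [::] (upd T j (inp E u)) true.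
Proof.
move=> ij ei ej.
(* Loop invariant: both heads are at position [k], and tape [j] holds the first [k] bits. *)
pose Tk k := upd (upd T i (shift (inp E u) (Posz k))) j
               (shift (inp E (take k u)) (Posz k)).
have eT : T = Tk 0.
  by rewrite /Tk take0 !shift0 -{1}ei -ej upd_id upd_id.
have e1 : exec (loop (isbit i) (seqf (one j (fun L => (L i, MoveRight)))
    (shiftf i MoveRight))) T (size u * 5) [::] (Tk (size u)) true.
  rewrite {1}eT; apply: exec_loop_iter => [k lt|]; last first.
    by rewrite /isbit /Tk updN // updE /shift add0r isbit_inp ltnn.
  split; first by rewrite /isbit /Tk updN // updE /shift add0r isbit_inp.
  have E1 := exec_one j (fun L => (L i, MoveRight)) (Tk k).
  have E2 := exec_seq E1 (exec_shiftf i MoveRight _).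
  exists true; suff <- : upd (upd (Tk k) j (twm (Tk k i 0%R, MoveRight) (Tk k j))) i
    (shift (upd (Tk k) j (twm (Tk k i 0%R, MoveRight) (Tk k j)) i) (off MoveRight)) = Tk k.+1
    by [].
  rewrite {2 3 4 6}/Tk !updE !(updN _ _ ij) !updE /Tk upd_upd.
  rewrite updC 1?eq_sym // upd_upd; congr upd.
    by rewrite shift_shift; congr (upd _ _ (shift _ _)); rewrite /=; lia.
  have lk : size (take k u) = k by rewrite size_takel // ltnW.
  have -> : shift (inp E u) k 0%R = bit_letter E (nth true u k).
    by rewrite /shift add0r /= (nth_map true).
  by have := twm_write E (take k u) (nth true u k); rewrite lk -take_nth.
have e2 : exec (rewind i) (Tk (size u)) (3 * size u + 4) [::]
    (upd (Tk (size u)) i (inp E u)) true.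
  by apply: exec_rewind; rewrite // /Tk updN // updE.
have e3 : exec (rewind j) (upd (Tk (size u)) i (inp E u)) (3 * size u + 4) [::]
    (upd T j (inp E u)) true.
  have := @exec_rewind j (upd (Tk (size u)) i (inp E u)) u (size u) (leqnn _).
  rewrite updN 1?eq_sym // {1}/Tk updE take_size => /(_ erefl).
  rewrite [upd (upd _ _ _) _ _](_ : _ = upd T j (inp E u)) //.
  by apply: funext => k; rewrite /Tk /upd; case: eqP => // _; case: eqP => // ->.
have := exec_seq e1 (exec_seq e2 e3); apply: exec_leq; lia.
Qed.

Lemma readsP t u :
    (forall k, k <= size u -> bitof (t (Posz k)) = nth None (map Some u) k) ->
  reads t u.
Proof.
elim: u t => [|b u IH] t H; first exact: (H 0).
split; first exact: (H 0).
apply: IH => k le; rewrite /shift (_ : (_ + _)%R = Posz k.+1) ?(H k.+1) //.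
by rewrite /=; lia.
Qed.

Lemma reads_inp u k : reads (shift (inp E u) (Posz k)) (drop k u).
Proof.
apply: readsP => l _; rewrite /shift (_ : (_ + _)%R = Posz (l + k)) //.
by rewrite bitof_inp map_drop nth_drop addnC.
Qed.

Lemma reads_inp0 u : reads (inp E u) u.
Proof. by have := reads_inp u 0; rewrite drop0 shift0. Qed.

End Fragments.

(** * Compilation and embedding of machines *)

Section Compile.
Variables (a : nat) (J E : finType).
Let I : finType := ('I_a.+1 + J)%type.
Variable A : frag I E.

Definition tape_of (i : 'I_(a.+1 + #|J|)) : I :=
  match split i with inl k => inl k | inr k => inr (enum_val k) end.

Definition idx (i : I) : 'I_(a.+1 + #|J|) :=
  unsplit (match i with inl k => inl k | inr j => inr (enum_rank j) end).

Lemma idxK : cancel idx tape_of.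
Proof. by case=> i; rewrite /tape_of /idx unsplitK ?enum_rankK. Qed.

(** The argument tapes come first and the work tapes [J] are appended in enumeration order, so that
    [init] produces the tapes [initT]. *)
Definition compile : machine :=
  @Machine (a + #|J|) (fstate A) E (fentry A) (@facc _ _ A)
    (fun q s => imap (fun c => (c.1, [ffun i => c.2 (tape_of i)]))
                     (fdelta q (fun i => s (idx i)))).

Definition abs (c : config compile) : fstate A * (I -> tp E) :=
  (cstate c, fun i => den (ctapes c (idx i))).

Lemma fins_abs c : fins (abs c) = imap abs (mins c).
Proof.
have perf (c' : fstate A * (I -> letter E * move)) :
    (c'.1, fun i => twm (c'.2 i) (den (ctapes c (idx i)))) =
    abs (@perform compile (c'.1, [ffun i => c'.2 (tape_of i)]) c).
  congr (_, _); apply: funext => i.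
  by rewrite /perform /= !ffunE idxK den_write_move; case: (c'.2 i).
rewrite /fins /mins /current_instr /=.
have -> : (fun i => [ffun i0 => scanned (ctapes c i0)] (idx i)) =
          (fun i => den (ctapes c (idx i)) 0%R).
  by apply: funext => i; rewrite ffunE.
case: (fdelta _) => //= [c'|c']; first by rewrite -perf.
by congr Guess; apply: funext => b; rewrite -perf.
Qed.

Definition initT (args : seq (seq bool)) : I -> tp E := fun i =>
  match i with inl k => inp E (nth [::] args k) | inr _ => inp E [::] end.

Lemma abs_init args : size args = a.+1 ->
  abs (init compile args) = (fentry A, initT args).
Proof.
move=> sz; congr (_, _); apply: funext => -[k|j] /=; rewrite ffunE den_input_tape //.
by rewrite nth_default // sz /= leq_addr.
Qed.

Lemma compile_path args g d : size args = a.+1 ->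
    path_to args g d ->
  exists N, exec A (initT args) N g (abs d).2 (@accepting compile (cstate d)).
Proof.
move=> sz [[n /runE R] /haltedE h]; exists n, n, (cstate d); split=> //.
  rewrite -abs_init //; apply: trun_map R => c _; exact: fins_abs.
by have := fins_abs d; rewrite h.
Qed.

Lemma path_compile args N g T b : size args = a.+1 ->
    exec A (initT args) N g T b ->
  exists2 d, path_to args g d & b = @accepting compile (cstate d).
Proof.
move=> sz [n [s [_]]]; rewrite -abs_init // => R h <-.
case: (trun_unmap fins_abs R) => d ed R'; exists d; last by case: ed => ->.
split; first by exists n; apply/runE.
by apply/haltedE; move: h; rewrite ed fins_abs; case: (mins d).
Qed.

Lemma compile_is_path args g : size args = a.+1 ->
  is_path compile args g <-> exists N T b, exec A (initT args) N g T b.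
Proof.
move=> sz; split=> [[d /(compile_path sz) [N e]]|[N [T [b /(path_compile sz)]]]].
  by exists N; do 2 eexists; exact: e.
by case=> d p _; exists d.
Qed.

Lemma compile_accepting args g : size args = a.+1 ->
  accepting_path compile args g <-> exists N T, exec A (initT args) N g T true.
Proof.
move=> sz; split=> [[d /(compile_path sz) [N e] ac]|[N [T /(path_compile sz)]]].
  by exists N, (abs d).2; rewrite ac in e.
by case=> d p e; exists d.
Qed.

(** Even an unfinished run follows some guess string; a comparable string on which the fragment
    halts within [N] steps forces the run to be part of that computation. *)
Lemma compile_bound args N : size args = a.+1 ->
    (forall g, exists g' r r' T b,
       g ++ r = g' ++ r' /\ exec A (initT args) N g' T b) ->
  forall n g (d : config compile), run (init compile args) n g d -> n <= N.
Proof.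
move=> sz H n g d /runE R.
have {}R : trun (@fins _ _ A) (fentry A, initT args) n g (abs d).
  by rewrite -abs_init //; apply: trun_map R => c _; exact: fins_abs.
case: (H g) => g' [r [r' [T [b [e [m [s [lem R' h _]]]]]]]].
case: (leqP n m) => [le|/ltnW le]; first exact: leq_trans lem.
case: (trun_prefix R' R le (esym e)) => g2 _ /(trun_halt h) [e' _ _]; lia.
Qed.

Lemma compile_polytime (q : {poly nat}) :
    (forall args g, size args = a.+1 -> exists g' r r' T b,
       g ++ r = g' ++ r' /\
       exec A (initT args) q.[sumn (map size args)]%R g' T b) ->
  polytime compile a.+1.
Proof.
by move=> H; exists q => args sz; apply: compile_bound => // g; apply: H.
Qed.

Lemma compile_deterministic : fdet A -> deterministic compile.
Proof.
by move=> dA s L c /=; case e: (fdelta _ _) => [||c'] //= _; case: (dA _ _ _ e).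
Qed.

Lemma compile_decides (q : {poly nat}) (P : seq (seq bool) -> Prop) :
    fdet A ->
    (forall args, size args = a.+1 -> exists T b,
       exec A (initT args) q.[sumn (map size args)]%R [::] T b /\ (b <-> P args)) ->
  [/\ deterministic compile, polytime compile a.+1 &
    forall args, size args = a.+1 -> P args <-> accepting_path compile args [::]].
Proof.
move=> dA H; split.
- exact: compile_deterministic.
- apply: (compile_polytime (q := q)) => args g sz; case: (H args sz) => T [b [e _]].
  by exists [::], [::], g, T, b; rewrite cats0.
- move=> args sz; case: (H args sz) => T [b [e iff]].
  rewrite -iff (compile_accepting _ sz); split=> [bt|[N [T' e']]].
    by rewrite bt in e; eexists _, _; exact: e.
  by case: (exec_unique (r := [::]) (r' := [::]) e e' erefl) => _ _ ->.
Qed.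

End Compile.

(** * Running a machine inside a fragment, with its own guesses or with guesses read from a tape *)

Lemma twm_map (E E' : Type) (f : letter E -> letter E') l m t :
  (fun z => f (twm (l, m) t z)) = twm (f l, m) (fun z => f (t z)).
Proof. by apply: funext => z; rewrite /twm; case: eqP. Qed.

Section Embed.
Variables (I E : finType) (N : machine) (e : 'I_(ntapes N).+1 -> I).
Variables (f : letter (aux N) -> letter E) (f' : letter E -> letter (aux N)).
Hypotheses (e_inj : injective e) (fK : cancel f f').
Implicit Types (T : I -> tp E) (c d : config N).

Definition place T c : I -> tp E := fun k =>
  if [pick i | e i == k] is Some i then fun z => f (den (ctapes c i) z) else T k.

Lemma pick_e i : [pick j | e j == e i] = Some i.
Proof.
case: pickP => [j /eqP/e_inj -> //|/(_ i)]; by rewrite eqxx.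
Qed.

Lemma place_in T c i : place T c (e i) = fun z => f (den (ctapes c i) z).
Proof. by rewrite /place pick_e. Qed.

Lemma place_out T c k : (forall i, e i != k) -> place T c k = T k.
Proof. by rewrite /place => H; case: pickP => // i; rewrite (negPf (H i)). Qed.

Lemma place_upd T c k t : (forall i, e i != k) ->
  place (upd T k t) c = upd (place T c) k t.
Proof.
move=> H; apply: funext => j; rewrite /place /upd.
by case: eqP => [->|//]; case: pickP => // i; rewrite (negPf (H i)).
Qed.

Definition emb_act (s : {ffun 'I_(ntapes N).+1 -> letter (aux N) * move})
    (L : I -> letter E) : I -> letter E * move := fun k =>
  if [pick i | e i == k] is Some i then (f (s i).1, (s i).2) else (L k, Stay).

Lemma place_perform T c s : 
  (fun k => twm (emb_act s.2 (fun k => place T c k 0%R) k) (place T c k)) =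
  place T (perform s c).
Proof.
apply: funext => k; rewrite /emb_act.
case: pickP => [i /eqP <-|H].
  by rewrite !place_in /perform ffunE den_write_move twm_map.
rewrite twm_keep shift0 !place_out //; by move=> i; rewrite H.
Qed.

Lemma place_scanned T c :
  [ffun i => f' (place T c (e i) 0%R)] = [ffun i => scanned (ctapes c i)].
Proof. by apply/ffunP => i; rewrite !ffunE place_in fK. Qed.

Definition runf (Q : pred (state N)) : frag I E :=
  @Frag I E (state N) (start N) Q
    (fun s L => imap (fun a => (a.1, emb_act a.2 L))
                     (delta s [ffun i => f' (L (e i))])).

Lemma fdet_runf Q : deterministic N -> fdet (runf Q).
Proof.
by move=> dN s L a /=; case e1: (delta _ _) => [||a'] //= _; case: (dN _ _ _ e1).
Qed.

Lemma fins_runf Q T c :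
  @fins _ _ (runf Q) (cstate c, place T c) =
  imap (fun c => (cstate c, place T c)) (mins c).
Proof.
rewrite /fins /mins /current_instr /= place_scanned.
case: (delta _ _) => //= [s|s]; first by rewrite place_perform.
by congr Guess; apply: funext => b; rewrite place_perform.
Qed.

Lemma exec_runf Q T args n g d :
    run (init N args) n g d -> halted d ->
  exec (runf Q) (place T (init N args)) n g (place T d) (Q (cstate d)).
Proof.
move=> /runE R /haltedE h; exists n, (cstate d); split=> //.
  apply: (trun_map (phi := fun c => (cstate c, place T c)) _ R) => c _.
  exact: fins_runf.
by rewrite fins_runf h.
Qed.

Lemma place_init T args :
    (forall i, T (e i) = inp E (nth [::] args i)) -> 
    (forall b, f (bit_letter _ b) = bit_letter _ b) -> f None = None ->
  place T (init N args) = T.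
Proof.
move=> H fb fn; apply: funext => k; rewrite /place; case: pickP => // i /eqP <-.
rewrite H ffunE den_input_tape; apply: funext => -[n|n] //=.
elim: (nth _ _ _) n => [|b s IH] [|n] //=; by rewrite fb.
Qed.

Variable gam : I.
Hypothesis gam_out : forall i, e i != gam.

(** Nondeterminism becomes input: each guess of [N] is read from tape [gam]. State [None] means that
    this tape ran out of bits, and it rejects. *)
Definition simf : frag I E :=
  @Frag I E (option (state N)) (Some (start N))
    (fun s => if s is Some s then accepting s else false)
    (fun s L => if s is Some s then
       match delta s [ffun i => f' (L (e i))] with
       | Halt => Halt
       | Step a => Step (Some a.1, emb_act a.2 L)
       | Guess a =>
           if bitof (L gam) is Some b then
             Step (Some (a b).1, fun k => if k == gam then (L k, MoveRight)
                                          else emb_act (a b).2 L k)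
           else Step (None, keep L)
       end else Halt).

Lemma fdet_simf : fdet simf.
Proof. by move=> [s|] L a //=; case: (delta _ _) => // a'; case: bitof. Qed.

Lemma trun_simf T c n g d r :
    trun (@mins N) c n g d -> reads (T gam) (g ++ r) ->
  trun (@fins _ _ simf) (Some (cstate c), place T c) n [::]
    (Some (cstate d), place (upd T gam (shift (T gam) (Posz (size g)))) d).
Proof.
move=> R; elim: R T => [{}c|{}c c1 {}n {}g {}d h _ IH|{}c s b {}n {}g {}d h _ IH] T /=.
- by move=> _; rewrite shift0 upd_id; apply: trun_refl.
- move=> rd; apply: trun_step (IH T rd).
  move: h; rewrite /fins /mins /current_instr /= place_scanned.
  by case: (delta _ _) => //= s [<-]; rewrite place_perform.
- move=> [eb rd]; pose T1 := upd T gam (shift (T gam) 1%R).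
  have rd1 : reads (T1 gam) (g ++ r) by rewrite /T1 updE.
  have := IH T1 rd1; rewrite {2 3}/T1 updE shift_shift upd_upd.
  rewrite (_ : (1 + Posz (size g))%R = Posz (size g).+1) //; apply: trun_step.
  move: h; rewrite /fins /mins /current_instr /= place_scanned.
  case: (delta _ _) => //= s' [<-]; rewrite place_out // eb.
  congr (Step (_, _)); rewrite place_upd // -place_perform.
  apply: funext => k; rewrite /upd /=; case: (k =P gam) => [->|//].
  by rewrite place_out // twm_keep.
Qed.

(** Rejection covers two cases, a rejecting halt and exhausted guesses. In both, prefix-freeness
    excludes an accepting path among all prefixes of [y]. *)
Lemma exec_simf T args B y :
    (forall n g d, run (init N args) n g d -> n <= B) -> reads (T gam) y ->
  exists T' b k, [/\ exec simf (place T (init N args)) B.+1 [::] T' b,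
    k <= size y, T' gam = shift (T gam) (Posz k),
    forall j, (forall i, e i != j) -> j != gam -> T' j = T j &
    if b then accepting_path N args (take k y)
    else forall k', ~ accepting_path N args (take k' y)].
Proof.
move=> bnd rd.
have bnd' n g d : trun (@mins N) (init N args) n g d -> n <= B.
  by move/runE/bnd.
case: (trun_progress y bnd') => [[k [n [d [lek R h]]]]|[n [d [s [R h]]]]].
  have rd' : reads (T gam) (take k y ++ drop k y) by rewrite cat_take_drop.
  have R' := trun_simf R rd'.
  exists (place (upd T gam (shift (T gam) (Posz (size (take k y))))) d).
  exists (accepting (cstate d)), k; split=> //.
  - exists n, (Some (cstate d)); split=> //; first exact: leqW (bnd' _ _ _ R).
    move: h; rewrite /fins /mins /current_instr /= place_scanned.
    by case: (delta _ _).
  - by rewrite place_out // updE size_takel.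
  - by move=> j je jg; rewrite place_out // updN.
  - case: ifP => ac.
      by exists d => //; split; [exists n; apply/runE|apply/haltedE].
    move=> k' [d' [[n' /runE R2] /haltedE h2] ac'].
    have e1 : take k y ++ drop k y = take k' y ++ drop k' y by rewrite !cat_take_drop.
    by case: (trun_halt_unique R h R2 h2 e1) => _ _ e2; rewrite e2 ac' in ac.
have rd' : reads (T gam) (y ++ [::]) by rewrite cats0.
have R' := trun_simf R rd'; set T1 := upd _ _ _ in R'.
have nbit : bitof (T1 gam 0%R) = None.
  rewrite /T1 updE; elim: (y) (T gam) rd => [|b u IH] t /=; first by rewrite shift0.
  by case=> _ /IH; rewrite shift_shift.
exists (place T1 d), false, (size y); split=> //.
- exists n.+1, None; split=> //; first exact: bnd' _ _ _ R.
  rewrite -addn1 -[[::]]cats0; apply: (trun_cat R'); apply: trun_step (trun_refl _ _).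
  move: h; rewrite /fins /mins /current_instr /= place_scanned.
  by case: (delta _ _) => //= s' _; rewrite place_out // nbit /= twm_stay.
- by rewrite place_out // /T1 updE.
- by move=> j je jg; rewrite place_out // /T1 updN.
(* After reading all of [y], [N] still asks for a guess. A halting run on a prefix of [y] can be
   neither an initial part of this run nor an extension of it, as an extension would consume one
   more bit. *)
- move=> k' [d' [[n' /runE R2] /haltedE h2] _].
  have e1 : take k' y ++ drop k' y = y ++ [::] by rewrite cat_take_drop cats0.
  case: (leqP n' n) => [le|/ltnW le].
    case: (trun_prefix R2 R le e1) => g2 ey /(trun_halt h2) [_ _ ed].
    by rewrite ed h2 in h.
  case: (trun_prefix R R2 le (esym e1)) => g2 ey.
  move=> R3; have : size (take k' y) <= size y by rewrite size_take_min geq_minr.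
  rewrite {1}ey size_cat -{2}[size y]addn0 leq_add2l leqn0 => /nilP eg.
  by rewrite eg in R3; inversion R3; congruence.
Qed.

End Embed.

(** * Replaying a machine on the output of another *)

Definition polyb (F : nat -> nat) : Prop :=
  exists q : {poly nat}, forall n, F n <= q.[n]%R.

Lemma polybD F G : polyb F -> polyb G -> polyb (fun n => F n + G n).
Proof.
move=> [q hq] [r hr]; exists (q + r)%R => n.
by rewrite hornerD; apply: leq_add.
Qed.

Lemma polybM F G : polyb F -> polyb G -> polyb (fun n => F n * G n).
Proof.
move=> [q hq] [r hr]; exists (q * r)%R => n.
by rewrite hornerM; apply: leq_mul.
Qed.

Lemma polyb_const c : polyb (fun => c).
Proof. by exists (c%:P)%R => n; rewrite hornerC. Qed.

Lemma polyb_id : polyb id.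
Proof. by exists 'X%R => n; rewrite hornerX. Qed.

Lemma polyb_horner (q : {poly nat}) : polyb (fun n => q.[n]%R).
Proof. by exists q. Qed.

Ltac polyb_tac := repeat first [exact: polyb_const | exact: polyb_id
  | exact: polyb_horner | apply: polybD | apply: polybM].

Lemma horner_mono (q : {poly nat}) m n : m <= n -> q.[m]%R <= q.[n]%R.
Proof.
move=> le; rewrite /horner; elim: (polyseq q) => //= c s IH.
by apply: leq_add => //; apply: leq_mul.
Qed.

Lemma reads_tape_word (E E' : Type) (f : letter E -> letter E') (t : tape E) :
    (forall l, bitof (f l) = bitof l) ->
  reads (fun z => f (den t z)) (tape_word t).
Proof.
move=> f_bit; apply: readsP => k; rewrite f_bit /tape_word.
have -> : den t (Posz k) = nth None (scanned t :: rcells t) k by case: k.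
elim: (_ :: _) k => [|[[b|x]|] s IH] [|k] //=; exact: IH.
Qed.

Lemma reads_drop (E : Type) (t : tp E) u k : k <= size u -> reads t u ->
  reads (shift t (Posz k)) (drop k u).
Proof.
elim: k t u => [|k IH] t u; first by rewrite shift0 drop0.
case: u => [//|b u] le [_ /(IH _ _ le)]; rewrite shift_shift.
by rewrite (_ : (1 + Posz k)%R = Posz k.+1).
Qed.

Definition skip (I : finType) (E : Type) : frag I E := test (fun => true).
Definition reject (I : finType) (E : Type) : frag I E := test (fun => false).

(** Extend [g] by [B.+1] default bits: a run of at most [B] steps cannot use them all up, so it must
    halt on the way. *)
Lemma total_path (N : machine) (args : seq (seq bool)) B g :
    (forall n g d, run (init N args) n g d -> n <= B) ->
  exists g' r r' d, [/\ g ++ r = g' ++ r', path_to args g' d &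
    exists2 n, n <= B & run (init N args) n g' d].
Proof.
move=> bnd; have bnd' n h d : trun (@mins N) (init N args) n h d -> n <= B.
  by move/runE/bnd.
case: (trun_progress (g ++ nseq B.+1 false) bnd') => [[k [n [d [lek R h]]]]|].
  exists (take k (g ++ nseq B.+1 false)), (nseq B.+1 false).
  exists (drop k (g ++ nseq B.+1 false)), d; split; first by rewrite cat_take_drop.
    by split; [exists n; apply/runE|apply/haltedE].
  by exists n; [exact: bnd' R|apply/runE].
move=> [n [d [s [R _]]]]; have := bnd' _ _ _ R; have := trun_size R.
by rewrite size_cat size_nseq; lia.
Qed.

Section Guided.
Variables (T N : machine) (Q : pred (state T)) (pol : bool).
Let EE : finType := (aux T + aux N)%type.
Let II : finType := ('I_1 + ('I_(ntapes T).+1 + 'I_(ntapes N).+1))%type.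

(** The two auxiliary alphabets are kept apart but bits are shared, so [N] can read the output of
    [T] as guesses. The decoding sends foreign letters to the blank. *)
Let fT (l : letter (aux T)) : letter EE :=
  match l with
  | Some (inr a) => Some (inr (inl a)) | Some (inl b) => Some (inl b)
  | None => None end.
Let fT' (l : letter EE) : letter (aux T) :=
  match l with
  | Some (inr (inl a)) => Some (inr a) | Some (inl b) => Some (inl b)
  | _ => None end.
Let fN (l : letter (aux N)) : letter EE :=
  match l with
  | Some (inr a) => Some (inr (inr a)) | Some (inl b) => Some (inl b)
  | None => None end.
Let fN' (l : letter EE) : letter (aux N) :=
  match l with
  | Some (inr (inr a)) => Some (inr a) | Some (inl b) => Some (inl b)
  | _ => None end.

Let eT (i : 'I_(ntapes T).+1) : II := inr (inl i).
Let eN (i : 'I_(ntapes N).+1) : II := inr (inr i).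

Let fTK : cancel fT fT'. Proof. by case=> [[]|]. Qed.
Let fNK : cancel fN fN'. Proof. by case=> [[]|]. Qed.
Let eT_inj : injective eT. Proof. by move=> i j []. Qed.
Let eN_inj : injective eN. Proof. by move=> i j []. Qed.

Let simN : frag II EE := simf eN fN fN' (eT ord_max).

Definition guidedf : frag II EE :=
  seqf (copy EE (inl ord0) (eT ord0)) (seqf (copy EE (inl ord0) (eN ord0))
    (branch (runf eT fT fT' Q) (if pol then simN else neg simN) (@reject II EE))).

Lemma fdet_guidedf : deterministic T -> fdet guidedf.
Proof.
move=> dT; have dG : fdet (branch (runf eT fT fT' Q)
    (if pol then simN else neg simN) (@reject II EE)).
  apply: fdet_branch; [exact: fdet_runf|case: pol|exact: fdet_test];
    exact: fdet_simf.
by do 2 (apply: fdet_branch; [exact: fdet_copy| |]); try exact: dG;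
  apply: fdet_branch => //; exact: fdet_copy.
Qed.

Lemma exec_guidedf x n g d B :
    run (init T [:: x]) n g d -> halted d ->
    (forall n g d, run (init N [:: x]) n g d -> n <= B) ->
  exists T' b, exec guidedf (@initT 0 _ EE [:: x]) (22 * size x + n + B + 30) g T' b /\
    (b <-> Q (cstate d) /\
       ((exists k, accepting_path N [:: x] (take k (output d))) <-> pol)).
Proof.
move=> R h bnd; set T0 := @initT _ _ _ _.
have e1 : exec (copy EE (inl ord0) (eT ord0)) T0 (11 * size x + 10) [::]
    (upd T0 (eT ord0) (inp _ x)) true by apply: exec_copy.
set T1 := upd _ _ _ in e1.
have e2 : exec (copy EE (inl ord0) (eN ord0)) T1 (11 * size x + 10) [::]
    (upd T1 (eN ord0) (inp _ x)) true by apply: exec_copy.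
set T2 := upd _ _ _ in e2.
have pT : place eT fT T2 (init T [:: x]) = T2.
  apply: place_init => // i; rewrite /T2 updN // /T1 /upd.
  by case: eqP => [[->]//|ne]; case: i ne => -[|i] lt ne //=; rewrite ?nth_nil //;
    case: ne; congr eT; apply: val_inj.
have e3 := exec_runf eT_inj fTK Q T2 R h; rewrite pT in e3.
set T3 := place _ _ _ _ in e3.
have pN : place eN fN T3 (init N [:: x]) = T3.
  apply: place_init => // i; rewrite /T3 place_out // /T2 /upd.
  by case: eqP => [[->]//|ne]; case: i ne => -[|i] lt ne //=; rewrite ?nth_nil //;
    case: ne; congr eN; apply: val_inj.
have rd : reads (T3 (eT ord_max)) (output d).
  rewrite /T3 place_in //; apply: reads_tape_word; by case=> [[]|].
have eNT i : eN i != eT ord_max by [].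
have [T4 [b [k [e4 _ _ _ hb]]]] := exec_simf eN_inj fNK eNT bnd rd.
rewrite pN in e4.
have e5 : exec (if pol then simN else neg simN) T3 B.+1 [::] T4 (b == pol).
  case: (pol); first by rewrite eqb_id.
  by rewrite eqbF_neg; apply: exec_neg.
have {}hb : (exists k, accepting_path N [:: x] (take k (output d))) <-> b.
  case: b hb {e4 e5} => hb; first by split=> // _; exists k.
  by split=> // -[k' /hb].
exists (if Q (cstate d) then T4 else T3), (Q (cstate d) && (b == pol)); split.
  have e6 : exec (branch (runf eT fT fT' Q) (if pol then simN else neg simN)
      (@reject II EE)) T2 (n + B.+2).+1 (g ++ [::])
      (if Q (cstate d) then T4 else T3) (Q (cstate d) && (b == pol)).
    apply: (exec_branch e3); case: (Q _) => /=; first by apply: exec_leq e5.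
    by apply: exec_leq (exec_test _ _).
  rewrite cats0 in e6; have := exec_seq e1 (exec_seq e2 e6); apply: exec_leq; lia.
rewrite hb; case: (Q _); case: b {hb e4 e5}; case: (pol) => /=; split=> // -[] // _ [];
  do ?[by move=> /(_ isT)|by move=> _ /(_ isT)].
Qed.

End Guided.

(** Run [T], test its final state by [Q], then replay [N] on the output of [T] and compare the
    verdict with [pol]. The replay is deterministic, so the guesses are those of [T], and
    determinism or unambiguity of [T] carries over. A prefix of the output appears because [N] may
    halt before reading all of it. *)
Lemma guided (T N : machine) (Q : pred (state T)) (pol : bool) :
    polytime T 1 -> polytime N 1 ->
  exists M, [/\ polytime M 1, deterministic T -> deterministic M &
    forall x g, accepting_path M [:: x] g <-> exists d : config T,
      [/\ path_to [:: x] g d, Q (cstate d) &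
        (exists k, accepting_path N [:: x] (take k (output d))) <-> pol]].
Proof.
move=> [qT hT] [qN hN]; pose A := guidedf N Q pol.
have [q hq] : polyb (fun n => 22 * n + qT.[n]%R + qN.[n]%R + 30) by polyb_tac.
have run_exec x n g d : run (init T [:: x]) n g d -> halted d ->
  exists T' b, exec A (@initT 0 _ _ [:: x]) q.[sumn (map size [:: x])]%R g T' b /\
    (b <-> Q (cstate d) /\
       ((exists k, accepting_path N [:: x] (take k (output d))) <-> pol)).
  move=> R h; have bN := hN [:: x] erefl.
  have [T' [b [e iff]]] := exec_guidedf Q pol R h bN.
  exists T', b; split=> //; apply: exec_leq e; apply: leq_trans (hq _).
  have := hT [:: x] erefl _ _ _ R; rewrite /= addn0; lia.
exists (compile A); split.
- apply: (compile_polytime (q := q)) => -[//|x [|//]] g _.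
  have [g' [r [r' [d [eg [_ h] [n _ R]]]]]] := total_path g (hT [:: x] erefl).
  have [T' [b [e _]]] := run_exec _ _ _ _ R h.
  by exists g', r, r', T', b.
- by move=> /(@fdet_guidedf T N Q pol); apply: compile_deterministic.
move=> x g; rewrite compile_accepting //; split=> [[B [U e]]|[d [[[n R] h] q1 q2]]].
  have [g' [r [r' [d [eg p [n _ R]]]]]] := total_path g (hT [:: x] erefl).
  have [T' [b [e' iff]]] := run_exec _ _ _ _ R p.2.
  case: (exec_unique e e' eg) => ? _ bt; subst g' b.
  by exists d; case: (iff.1 erefl).
have [T' [b [e iff]]] := run_exec _ _ _ _ R h.
by eexists _, T'; rewrite -(iff.2 (conj q1 q2)); exact: e.
Qed.

(** * The hard instance *)

(** Accepting guess strings of a UP machine may have any length up to its running time; zeros bring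
    them to one length, and prefix-freeness makes the split point unique. *)
Definition padded_witness (N : machine) (x y : seq bool) : Prop :=
  exists2 k, k <= size y &
    accepting_path N [:: x] (take k y) /\ all negb (drop k y).

Section Verifier.
Variables (I : finType) (N : machine) (e : 'I_(ntapes N).+1 -> I) (gam : I).
Hypotheses (e_inj : injective e) (gam_out : forall i, e i != gam).
Let E := aux N.

Definition verf : frag I E :=
  branch (simf e id id gam)
    (dfa E gam gam (fun z a _ => z && ~~ a) true id) (@reject I E).

Lemma foldl_zeros (u : seq bool) z :
  foldl (fun z (ab : bool * bool) => z && ~~ ab.1) z (zip u u) = z && all negb u.
Proof. by elim: u z => [|b u IH] z /=; rewrite ?andbT // IH andbA. Qed.

Lemma exec_verf T x B y :
    (forall i, T (e i) = inp E (nth [::] [:: x] i)) -> reads (T gam) y ->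
    (forall n g d, run (init N [:: x]) n g d -> n <= B) ->
  exists T' b, [/\ exec verf T (B + size y + 5) [::] T' b,
    forall j, (forall i, e i != j) -> j != gam -> T' j = T j &
    b <-> padded_witness N x y].
Proof.
move=> eT rd bnd.
have pN : place e id T (init N [:: x]) = T by apply: place_init.
have idK : cancel (@id (letter E)) id by [].
have [T1 [b [k [e1 lek eg frame hb]]]] := exec_simf e_inj idK gam_out bnd rd.
rewrite pN in e1; case: b e1 hb => e1 hb; last first.
  exists T1, false; split=> //; last by split=> // -[k' _ [/hb]].
  by apply: exec_leq _ (exec_branch e1 (exec_test _ _)); lia.
have rd1 : reads (T1 gam) (drop k y) by rewrite eg; apply: reads_drop.
have [T2 e2 frame2] := exec_dfa (fun z a _ => z && ~~ a) true id rd1 rd1.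
rewrite foldl_zeros in e2.
exists T2, (all negb (drop k y)); split.
  by apply: exec_leq _ (exec_branch e1 e2); rewrite size_drop; lia.
  by move=> j je jg; rewrite frame2 // frame.
split=> [al|]; first by exists k.
(* Two halting guess strings that are prefixes of the same [y] coincide, so the tail checked by the
   automaton is the right one. *)
case=> k' lek' [[d' p' _] al]; case: hb => d p _.
have e3 : take k y ++ drop k y = take k' y ++ drop k' y by rewrite !cat_take_drop.
have [et _] := path_to_unique p p' e3.
by have := congr1 size et; rewrite !size_takel // => ->.
Qed.

End Verifier.

(** * Guessing exactly p(|x|) bits by Horner's scheme *)

Section Hard.
Variables (N : machine) (q : {poly nat}).
Hypothesis time_N : forall x n g d, run (init N [:: x]) n g d -> n <= q.[size x]%R.
Let E := aux N.

Section Balanced.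
Variable p : {poly nat}.
Let D := size p.
Let I : finType := ('I_1 + ('I_(ntapes N).+1 + (unit + 'I_D.+1)))%type.
Let X : I := inl ord0.
Let e (i : 'I_(ntapes N).+1) : I := inr (inl i).
Let gam : I := inr (inr (inl tt)).
Let clk (k : nat) : I := inr (inr (inr (inord k))).
Implicit Types T : I -> tp E.

Let clk_neq j k : j < k -> k < D.+1 -> clk j != clk k.
Proof.
move=> jk kD; apply/eqP => -[] /(congr1 val); rewrite /= !inordK //; lia.
Qed.

Fixpoint guesses (c : nat) : frag I E :=
  if c is c'.+1 then seqf (guess_bit E gam) (guesses c') else @skip I E.

(** Horner's rule as nested loops: the value c + n * v is spent as [c] guesses followed by a loop
    over the [n] cells of a copy of the input, whose body spends [v]. Every nesting level owns one
    copy as its counter. *)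
Fixpoint clockf (s : seq nat) : frag I E :=
  if s is c :: s' then
    seqf (guesses c)
      (seqf (loop (isbit (E := E) (clk (size s')))
               (seqf (shiftf E (clk (size s')) MoveRight) (clockf s')))
            (rewind E (clk (size s'))))
  else @skip I E.

Fixpoint clock_cost (s : seq nat) (n : nat) : nat :=
  if s is c :: s' then 2 * c + n * (clock_cost s' n + 7) + 10 else 1.

Let G T u := upd T gam (shift (inp E u) (Posz (size u))).

Lemma exec_guesses c T u g : size g = c ->
  exec (guesses c) (G T u) (2 * c + 1) g (G T (u ++ g)) true.
Proof.
elim: c u g => [|c IH] u [|b g] //=.
  by rewrite cats0 => _; apply: exec_test.
move=> [sg]; have := exec_guess_bit gam (G T u) b.
rewrite {2 3}/G updE upd_upd twm_write -(size_rcons u b).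
move=> e1; have := exec_seq e1 (IH (rcons u b) g sg).
by rewrite cat_rcons; apply: exec_leq; lia.
Qed.

Lemma exec_clock s x T u g :
    size s <= D.+1 -> (forall k, k < size s -> T (clk k) = inp E x) ->
    size g = horner_rec s (size x) ->
  exec (clockf s) (G T u) (clock_cost s (size x)) g (G T (u ++ g)) true.
Proof.
elim: s T u g => [|c s IH] T u g sD Tx.
  by case: g => // _; rewrite cats0; apply: exec_test.
rewrite /= => sg; set n := size x in sg *; set C := clk (size s).
have gC : gam != C by [].
set m := horner_rec s n in sg.
(* Induction on the remaining rounds [j], with the clock head at position [k] and the guesses so far
   in [u']; each round takes the next [m] guesses. *)
have loop_ok j k u' g' : k + j = n -> size g' = j * m ->
    exec (loop (isbit (E := E) C) (seqf (shiftf E C MoveRight) (clockf s)))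
      (upd (G T u') C (shift (inp E x) (Posz k))) (j * (clock_cost s n + 4)) g'
      (upd (G T (u' ++ g')) C (shift (inp E x) (Posz n))) true.
  elim: j k u' g' => [|j IHj] k u' g' kj sg'.
    case: g' sg' => // _; rewrite cats0 -kj addn0; apply: exec_loop_end.
    by rewrite /isbit updE /shift add0r isbit_inp; lia.
  have bit : isbit C (fun i => upd (G T u') C (shift (inp E x) (Posz k)) i 0%R).
    by rewrite /isbit updE /shift add0r isbit_inp; lia.
  have e1 := exec_shiftf C MoveRight (upd (G T u') C (shift (inp E x) (Posz k))).
  rewrite updE upd_upd shift_shift /= in e1.
  have stk : size (take m g') = m by rewrite size_takel // sg' mulSn leq_addr.
  have e2 : exec (clockf s) (upd (G T u') C (shift (inp E x) (Posz k.+1)))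
      (clock_cost s n) (take m g')
      (upd (G T (u' ++ take m g')) C (shift (inp E x) (Posz k.+1))) true.
    rewrite /G 2!(updC _ _ _ gC); apply: IH => //; first exact: ltnW.
    by move=> l ls; rewrite updN; [apply: Tx; apply: ltnW|exact: clk_neq].
  rewrite (_ : (Posz k + 1)%R = Posz k.+1) in e1; last by lia.
  have sg2 : size (drop m g') = j * m by rewrite size_drop sg'; lia.
  have e3 := IHj k.+1 (u' ++ take m g') (drop m g') _ sg2.
  rewrite -catA cat_take_drop in e3.
  have {}e3 := e3 (eq_trans (addSnnS k j) kj).
  have := exec_loop_step bit (exec_seq e1 e2) e3.
  by rewrite /= cat_take_drop; apply: exec_leq; lia.
have lec : c <= size g by rewrite sg leq_addl.
have sc : size (take c g) = c by rewrite size_takel.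
have e1 := exec_guesses T u sc.
have sd : size (drop c g) = n * m by rewrite size_drop sg mulnC; lia.
have e2 := loop_ok n 0 (u ++ take c g) (drop c g) erefl sd.
rewrite -catA cat_take_drop shift0 in e2.
have TC : T C = inp E x by apply: Tx.
have GC w : upd (G T w) C (inp E x) = G T w.
  rewrite -TC -{1}(updN T (shift (inp E w) (Posz (size w))) (i := gam) (k := C)).
    by rewrite upd_id.
  by rewrite eq_sym.
rewrite GC in e2.
have e3 := exec_rewind (leqnn n) (updE (G T (u ++ g)) C (shift (inp E x) n)).
rewrite upd_upd GC in e3.
have := exec_seq e1 (exec_seq e2 e3).
rewrite cats0 cat_take_drop; apply: exec_leq; rewrite /= -/n; lia.
Qed.

Lemma polyb_clock_cost s : polyb (clock_cost s).
Proof. by elim: s => [|c s IH] /=; polyb_tac. Qed.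

Fixpoint copies (k : nat) : frag I E :=
  if k is k'.+1 then seqf (copy E X (clk k')) (copies k') else @skip I E.

Lemma exec_copies k T x :
    k <= D.+1 -> T X = inp E x -> (forall j, j < k -> T (clk j) = inp E [::]) ->
  exists T', [/\ exec (copies k) T (k * (11 * size x + 11) + 1) [::] T' true,
    forall j, j < k -> T' (clk j) = inp E x &
    forall i, (forall j, j < k -> i != clk j) -> T' i = T i].
Proof.
elim: k T => [|k IH] T kD TX Tc.
  by exists T; split=> //; apply: exec_test.
have e1 : exec (copy E X (clk k)) T (11 * size x + 10) [::]
    (upd T (clk k) (inp E x)) true by apply: exec_copy => //; apply: Tc.
case: (IH (upd T (clk k) (inp E x)) (ltnW kD)) => [||T' [e2 Ti To]].
- by rewrite updN.
- by move=> j jk; rewrite updN ?clk_neq // Tc // ltnW.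
exists T'; split.
- by have := exec_seq e1 e2; apply: exec_leq; lia.
- move=> j; rewrite ltnS leq_eqVlt => /orP[/eqP ->|/Ti//].
  by rewrite To ?updE // => l lk; rewrite eq_sym clk_neq.
- move=> i ne; rewrite To ?updN ?ne // => j jk; exact/ne/ltnW.
Qed.

(** All guessing precedes the deterministic check, so the number of guesses is p(|x|) whatever the
    verdict; the negation turns the one verified path into the one rejected path. *)
Definition clocked_verf : frag I E :=
  seqf (copy E X (e ord0)) (seqf (copies D) (seqf (clockf p) (seqf (rewind E gam)
    (neg (branch (test (fun L => bitof (L gam) == Some false))
            (seqf (shiftf E gam MoveRight) (verf e gam)) (@reject I E)))))).

Definition bad_path (x g : seq bool) : Prop :=
  exists2 y, g = false :: y & padded_witness N x y.

Lemma exec_clocked_verf : exists r : {poly nat}, forall x g,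
    size g = p.[size x]%R ->
  exists T' b, exec clocked_verf (@initT 0 _ E [:: x]) r.[size x]%R g T' b /\
    (b <-> ~ bad_path x g).
Proof.
have [r hr] : polyb (fun n => 11 * n + D * (11 * n + 11) + clock_cost p n +
  4 * p.[n]%R + q.[n]%R + 60) by polyb_tac; exact: polyb_clock_cost.
exists r => x g sg; set T0 := initT _ _.
have e1 : exec (copy E X (e ord0)) T0 (11 * size x + 10) [::]
    (upd T0 (e ord0) (inp E x)) true by apply: exec_copy.
set T1 := upd _ _ _ in e1.
have [T2 [e2 T2c T2o]] : exists T', [/\
    exec (copies D) T1 (D * (11 * size x + 11) + 1) [::] T' true,
    forall j, j < D -> T' (clk j) = inp E x &
    forall i, (forall j, j < D -> i != clk j) -> T' i = T1 i].
  by apply: exec_copies.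
have T2g : T2 gam = inp E [::] by rewrite T2o.
have e3 := @exec_clock p x T2 [::] g (leqnSn _) T2c sg.
rewrite {1}/G shift0 -T2g upd_id in e3.
have e4 := exec_rewind (leqnn (size g)) (updE T2 gam (shift (inp E g) (Posz (size g)))).
rewrite upd_upd in e4; set T3 := upd T2 gam (inp E g) in e4.
have [T4 [b [e5 hb]]] : exists T' b, exec (branch
      (test (fun L => bitof (L gam) == Some false))
      (seqf (shiftf E gam MoveRight) (verf e gam)) (@reject I E))
    T3 (q.[size x]%R + size g + 10) [::] T' b /\ (b <-> bad_path x g).
  have e5 : exec (test (fun L => bitof (L gam) == Some false)) T3 1 [::] T3
    (bitof (T3 gam 0%R) == Some false) := exec_test _ _.
  have bg : bitof (T3 gam 0%R) = nth None (map Some g) 0.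
    by rewrite /T3 updE; exact: (bitof_inp E g 0).
  case: (boolP (bitof (T3 gam 0%R) == Some false)) e5 => z e5; last first.
    exists T3, false; split; last first.
      by split=> // -[y eg _]; rewrite bg eg in z.
    by apply: exec_leq _ (exec_branch e5 (exec_test _ _)); lia.
  have [y eg] : exists y, g = false :: y.
    by move: z; rewrite bg; case: (g) => [//|[] // y _]; exists y.
  have e6 := exec_shiftf gam MoveRight T3; set T4 := upd _ _ _ in e6.
  have T4e i : T4 (e i) = inp E (nth [::] [:: x] i).
    rewrite /T4 updN // /T3 updN // T2o // /T1 /upd.
    case: eqP => [[->]//|ne]; case: i ne => -[|i] lt ne /=; rewrite ?nth_nil //.
    by case: ne; congr e; apply: val_inj.
  have rd : reads (T4 gam) y.
    rewrite /T4 updE /T3 updE -[y]drop0.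
    by have := reads_inp E g 1; rewrite eg.
  have [T5 [b [e7 _ hb]]] := exec_verf (e := e) (gam := gam)
    (fun i j (h : e i = e j) => ltac:(by case: h)) (fun i => isT) T4e rd (time_N (x := x)).
  exists T5, b; split.
    have := exec_branch e5 (B := seqf (shiftf E gam MoveRight) (verf e gam))
      (C := @reject I E) (exec_seq e6 e7).
    by apply: exec_leq; rewrite eg /=; lia.
  rewrite hb; split=> [w|[y' eg' w]]; first by exists y.
  by move: eg'; rewrite eg => -[->].
exists T4, (~~ b); split; last first.
  by rewrite -hb; case: (b); split=> // h; case: h.
have := exec_seq e1 (exec_seq e2 (exec_seq e3 (exec_seq e4 (exec_neg e5)))).
rewrite /= cats0; apply: exec_leq; apply: leq_trans (hr _); rewrite sg; lia.
Qed.

End Balanced.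
End Hard.

Lemma balanced_machine (N : machine) (q p : {poly nat}) :
    (forall x n g d, run (init N [:: x]) n g d -> n <= q.[size x]%R) ->
  exists M, [/\ NPTM M, balanced p M & forall x g, size g = p.[size x]%R ->
    (accepting_path M [:: x] g <-> ~ bad_path N x g)].
Proof.
move=> time_N; have [r hr] := exec_clocked_verf time_N p.
set A := clocked_verf N p in hr; exists (compile A).
(* Any [g], extended by p(|x|) zeros, has a prefix of length p(|x|) on which the program halts. By
   prefix-freeness, a path [g] must be that prefix. *)
have total (x g : seq bool) : exists r' T b g2,
    [/\ g ++ nseq p.[size x]%R false = g2 ++ r', size g2 = p.[size x]%R &
    exec A (@initT 0 _ _ [:: x]) r.[size x]%R g2 T b].
  set n := p.[_]%R; pose u := g ++ nseq n false.
  have su : size (take n u) = n.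
    by rewrite size_takel // size_cat size_nseq leq_addl.
  case: (hr x _ su) => T [b [e _]].
  by exists (drop n u), T, b, (take n u); rewrite cat_take_drop.
split.
- apply: (compile_polytime (q := r)) => -[//|x [|//]] g _.
  case: (total x g) => r' [T [b [g2 [eg _ e]]]].
  by exists g2, (nseq p.[size x]%R false), r', T, b; rewrite /= addn0.
- move=> x g; rewrite compile_is_path //; split=> [[B [T [b e]]]|/hr].
    case: (total x g) => r' [T' [b' [g2 [eg sg e']]]].
    by case: (exec_unique e e' eg) => -> _ _.
  by case=> T [b [e _]]; exists r.[size x]%R, T, b.
- move=> x g /hr [T [b [e iff]]]; rewrite -iff compile_accepting //.
  split=> [[B [T' e']]|bt]; last by rewrite bt in e; eexists _, _; exact: e.
  by case: (exec_unique (r := [::]) (r' := [::]) e e' erefl) => _ _ ->.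
Qed.

(** * Adjacency as a finite automaton *)

Definition cmp_state : finType := option (bool * bool * (bool * bool * bool * bool)).

(* After the first letters a and c, the four flags compare the remaining words *)
(* y and z read as binary numbers: z = y, z = y + 1, y = 1...1, z = 0...0.     *)
Definition cmp_step (s : cmp_state) (a c : bool) : cmp_state :=
  if s is Some (a0, c0, (eq, sc, on, ze)) then
    Some (a0, c0, (eq && (a == c), sc && a && ~~ c || eq && ~~ a && c,
                   on && a, ze && ~~ c))
  else Some (a, c, (true, false, true, true)).

Definition cmp (y z : seq bool) : cmp_state :=
  foldl (fun s ab => cmp_step s ab.1 ab.2) None (zip y z).

(** In the order by 2y + a, the successor of 0y is 1y, that of 1y is 0(y + 1), and 11...1 wraps
    around to 00...0. *)
Definition circ_fin (s : cmp_state) : bool :=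
  if s is Some (a, c, (eq, sc, on, ze)) then
    if a then ~~ c && (sc || on && ze) else c && eq
  else false.

(** [w] tells whether the tail of the second string is the padded witness. If so, its 0-version now
    follows the old last string 11...1, and its 1-version inherits the predecessor 1(z - 1). The old
    successor of 0w is 1w, whose tail is again the witness, so examining the second string alone
    suffices. *)
Definition free_fin (w : bool) (s : cmp_state) : bool :=
  if s is Some (a, c, (eq, sc, on, ze)) then
    if w then a && (if c then sc else on)
    else if a then ~~ c && sc else c && eq
  else false.

Definition bval (s : seq bool) : nat := foldl (fun n (b : bool) => n.*2 + b) 0 s.

Lemma bval_rcons s b : bval (rcons s b) = (bval s).*2 + b.
Proof. by rewrite /bval foldl_rcons. Qed.

Lemma bval_lt s : bval s < 2 ^ size s.
Proof.
elim/last_ind: s => [//|s b IH]; rewrite bval_rcons size_rcons expnS.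
by case: b; lia.
Qed.

Lemma bval_inj s t : size s = size t -> bval s = bval t -> s = t.
Proof.
elim/last_ind: s t => [|s b IH] t; first by case: t.
case/lastP: t => [|t c]; first by rewrite size_rcons.
rewrite !size_rcons !bval_rcons => -[st] e.
have [e1 e2] : b = c /\ bval s = bval t by case: b e; case: c; lia.
by rewrite e1 (IH t).
Qed.

(** Words are read from the most significant bit on; after one more low-order bit in each, the new
    flags depend only on the old flags and these two bits. *)
Lemma cmp_cons a c y z : size y = size z ->
  cmp (a :: y) (c :: z) =
  Some (a, c, (bval z == bval y, bval z == (bval y).+1,
               (bval y).+1 == 2 ^ size y, bval z == 0)).
Proof.
rewrite /cmp /=; elim/last_ind: y z => [|y b IH] z.
  by case: z => //=.
case/lastP: z => [|z d]; first by rewrite size_rcons.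
rewrite !size_rcons => -[sz]; rewrite zip_rcons // foldl_rcons IH //=.
have split4 (b1 b2 b3 b4 c1 c2 c3 c4 : bool) : b1 = c1 -> b2 = c2 -> b3 = c3 ->
    b4 = c4 -> (b1, b2, b3, b4) = (c1, c2, c3, c4) by move=> -> -> -> ->.
rewrite !bval_rcons expnS; congr (Some (_, _, _)); apply: split4;
by case: b; case: d; rewrite /= ?andbT ?andbF ?orbF ?orbT //; lia.
Qed.

Lemma circ_prec_polytime : polytime_pred3 (fun _ y z => circ_fin (cmp y z)).
Proof.
pose I : finType := ('I_3 + void)%type.
pose A : frag I void :=
  dfa void (inl (inord 1)) (inl (inord 2)) cmp_step None circ_fin.
have [||dM pM hM] := @compile_decides 2 _ _ A ('X + 1)%R
  (fun args => circ_fin (cmp (nth [::] args 1) (nth [::] args 2))).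
- exact: fdet_dfa.
- case=> [|x [|y [|z [|]]]] // _.
  have ry : reads (@initT 2 void void [:: x; y; z] (inl (inord 1))) y.
    by rewrite /initT inordK //; apply: reads_inp0.
  have rz : reads (@initT 2 void void [:: x; y; z] (inl (inord 2))) z.
    by rewrite /initT inordK //; apply: reads_inp0.
  have [T e _] := exec_dfa cmp_step None circ_fin ry rz.
  eexists _, _; split; first apply: exec_leq e; last by [].
  by rewrite hornerD hornerX hornerC /= /GRing.add /= /GRing.one /=; lia.
by exists (compile A); split=> // x y z; rewrite -hM.
Qed.

Section FreePrec.
Variables (N : machine) (q : {poly nat}).
Hypothesis time_N : forall x n g d, run (init N [:: x]) n g d -> n <= q.[size x]%R.
Let E := aux N.
Let I : finType := ('I_3 + ('I_(ntapes N).+1 + unit))%type.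
Let tX : I := inl (inord 0).
Let tY : I := inl (inord 1).
Let tZ : I := inl (inord 2).
Let e (i : 'I_(ntapes N).+1) : I := inr (inl i).
Let gam : I := inr (inr tt).

(** Tape [gam] receives a copy of [z] with its head moved past the first bit, so that the verifier
    sees the tail of [z]. *)
Definition free_precf : frag I E :=
  seqf (copy E tX (e ord0)) (seqf (copy E tZ gam) (seqf (shiftf E gam MoveRight)
    (branch (verf e gam)
      (dfa E tY tZ cmp_step None (free_fin true))
      (dfa E tY tZ cmp_step None (free_fin false))))).

Lemma exec_free_precf x y z :
  exists T w, exec free_precf (@initT 2 _ E [:: x; y; z])
      (11 * size x + 13 * size z + size y + q.[size x]%R + 60) [::] T
      (free_fin w (cmp y z)) /\
    (w <-> padded_witness N x (behead z)).
Proof.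
set T0 := initT _ _.
have e1 : exec (copy E tX (e ord0)) T0 (11 * size x + 10) [::]
    (upd T0 (e ord0) (inp E x)) true.
  by apply: exec_copy => //; rewrite /T0 /= inordK.
set T1 := upd _ _ _ in e1.
have e2 : exec (copy E tZ gam) T1 (11 * size z + 10) [::]
    (upd T1 gam (inp E z)) true.
  by apply: exec_copy => //; rewrite /T1 updN // /T0 /= inordK.
set T2 := upd _ _ _ in e2.
have e3 := exec_shiftf gam MoveRight T2; set T3 := upd _ _ _ in e3.
have T3e i : T3 (e i) = inp E (nth [::] [:: x] i).
  rewrite /T3 updN // /T2 updN // /T1 /upd.
  case: eqP => [[->]//|ne]; case: i ne => -[|i] lt ne /=; rewrite ?nth_nil //.
  by case: ne; congr e; apply: val_inj.
have rd : reads (T3 gam) (behead z).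
  by rewrite /T3 updE /T2 updE -drop1; apply: (reads_inp E z 1).
have e_inj : injective e by move=> i j [].
have e_gam i : e i != gam by [].
have [T4 [w [e4 frame hw]]] := exec_verf e_inj e_gam T3e rd (time_N (x := x)).
have ry : reads (T4 tY) y.
  rewrite frame // /T3 updN // /T2 updN // /T1 updN // /T0 /= inordK //.
  exact: reads_inp0.
have rz : reads (T4 tZ) z.
  rewrite frame // /T3 updN // /T2 updN // /T1 updN // /T0 /= inordK //.
  exact: reads_inp0.
have [T5 e5 _] := exec_dfa cmp_step None (free_fin w) ry rz.
have e6 : exec (if w then dfa E tY tZ cmp_step None (free_fin true)
    else dfa E tY tZ cmp_step None (free_fin false)) T4 (size y).+1 [::] T5
    (free_fin w (cmp y z)) by case: (w) e5.
exists T5, w; split=> //.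
have := exec_seq e1 (exec_seq e2 (exec_seq e3 (exec_branch e4 e6))).
by apply: exec_leq; rewrite size_behead; lia.
Qed.

Lemma free_prec_polytime : polytime_pred3 (fun x y z =>
  free_fin `[< padded_witness N x (behead z) >] (cmp y z)).
Proof.
have [r hr] : polyb (fun n => 13 * n + q.[n]%R + 60) by polyb_tac.
have [||dM pM hM] := @compile_decides 2 _ _ free_precf r
  (fun args => free_fin `[< padded_witness N (nth [::] args 0)
     (behead (nth [::] args 2)) >] (cmp (nth [::] args 1) (nth [::] args 2))).
- by do ![apply: fdet_branch|apply: fdet_loop|exact: fdet_one|exact: fdet_dfa
    |exact: fdet_simf|exact: fdet_test].
- case=> [|x [|y [|z [|]]]] // _.
  have [T [w [e1 hw]]] := exec_free_precf x y z.
  exists T, (free_fin w (cmp y z)); split.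
    apply: exec_leq e1; apply: leq_trans (hr _).
    have := @horner_mono q (size x) (sumn (map size [:: x; y; z])) (leq_addr _ _).
    by rewrite /=; lia.
  rewrite /=; suff -> : w = `[< padded_witness N x (behead z) >] by [].
  by apply/idP/asboolP => /hw.
by exists (compile free_precf); split=> // x y z; rewrite -hM.
Qed.

End FreePrec.

(** * Lexicographic ranks *)

Lemma bval_cons b s : bval (b :: s) = b * 2 ^ size s + bval s.
Proof.
elim/last_ind: s => [|s c IH]; first by case: b.
by rewrite -rcons_cons !bval_rcons IH size_rcons expnS; lia.
Qed.

Lemma bval_zeros n : bval (zeros n) = 0.
Proof. by rewrite /=; elim: n => //= n IH; rewrite bval_cons IH. Qed.

Lemma bval_ones n : bval (ones n) = (2 ^ n).-1.
Proof.
rewrite /=; elim: n => //= n IH; rewrite bval_cons IH size_nseq expnS.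
by have := expn_gt0 2 n; lia.
Qed.

Lemma lex_ltE n (a b : n.-tuple bool) : lex_lt a b = (bval a < bval b).
Proof.
rewrite /lex_lt.
have -> : ((a : n.-tuplelexi bool) < b)%O =
          ((tval a : seqlexi bool) < (tval b : seqlexi bool))%O by [].
case: a b => a sa [b sb] /=; move: sb; rewrite -(eqP sa) => /eqP/esym {n sa}.
elim: a b => [|x a IH] [|y b] //= [sab].
rewrite ltxi_cons IH // !bval_cons sab.
have := bval_lt a; have := bval_lt b; rewrite sab.
by case: x; case: y; rewrite /= ?mul1n ?mul0n ?add0n; lia.
Qed.

Lemma lex_leE n (a b : n.-tuple bool) : lex_le a b = (bval a <= bval b).
Proof. by rewrite leqNgt -lex_ltE /lex_le /lex_lt leNgt. Qed.

Lemma bval_tuple_inj n (a b : n.-tuple bool) : bval a = bval b -> a = b.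
Proof. by move=> e; apply/val_inj/bval_inj; rewrite ?size_tuple. Qed.

(** An injection between finite sets of equal size is onto. *)
Lemma bval_surj n k : k < 2 ^ n -> exists t : n.-tuple bool, bval t = k.
Proof.
move=> kn.
have lt (t : n.-tuple bool) : bval t < 2 ^ n.
  by rewrite -[n in 2 ^ n](size_tuple t) bval_lt.
have [g _ gK] : bijective (fun t : n.-tuple bool => Ordinal (lt t)).
  apply: inj_card_bij; last by rewrite card_ord card_tuple card_bool.
  by move=> s t [] /bval_tuple_inj.
by exists (g (Ordinal kn)); have := congr1 val (gK (Ordinal kn)).
Qed.

Lemma lex_succE n (a b : n.-tuple bool) :
  lex_succ a b <-> bval b = (bval a).+1.
Proof.
rewrite /lex_succ lex_ltE; split=> [[lt H]|e]; last first.
  by rewrite e; split=> // c; rewrite !lex_ltE e => -[]; lia.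
(* If the values differed by more than one, the string of value [(bval a).+1] would lie strictly
   between. *)
case: (ltngtP (bval a).+1 (bval b)) => // [lt2|]; last by lia.
have [|c ec] := @bval_surj n (bval a).+1.
  by apply: (ltn_trans lt2); rewrite -[n in 2 ^ n](size_tuple b) bval_lt.
by case: (H c); rewrite !lex_ltE ec.
Qed.

(** This lets the orders below be prescribed by arithmetic ranks instead of explicit
    permutations. *)
Lemma rank_perm n (R : n.-tuple bool -> nat) :
    (forall u, R u < 2 ^ n) -> (forall u v, R u = R v -> u = v) ->
  exists h : {perm n.-tuple bool}, forall u, bval (h u) = R u.
Proof.
move=> Rlt Rinj; pose g u := sval (cid (bval_surj (Rlt u))).
have gE u : bval (g u) = R u by rewrite /g; case: cid.
have g_inj : injective g.
  by move=> u v /(congr1 (fun t => bval (val t))); rewrite !gE => /Rinj.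
by exists (perm g_inj) => u; rewrite permE.
Qed.

(** The leading bit is taken as the least significant one, which makes 0y and 1y neighbours. *)
Definition rank0 (u : seq bool) : nat := 2 * bval (behead u) + head false u.

Lemma rank0_lt m (u : m.+1.-tuple bool) : rank0 u < 2 ^ m.+1.
Proof.
case/tupleP: u => a y; rewrite /rank0 /= expnS; have := bval_lt y.
by rewrite size_tuple; case: a; lia.
Qed.

Lemma rank0_inj m (u v : m.+1.-tuple bool) : rank0 u = rank0 v -> u = v.
Proof.
case/tupleP: u => a y; case/tupleP: v => c z; rewrite /rank0 /= => e.
have [ea ey] : a = c /\ bval y = bval z by case: a e; case: c; lia.
by rewrite ea (bval_tuple_inj ey).
Qed.

Lemma eq_ones m (u : m.-tuple bool) : u = ones m <-> bval u = (2 ^ m).-1.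
Proof.
by rewrite -bval_ones; split=> [->//|]; apply: bval_tuple_inj.
Qed.

Lemma eq_zeros m (u : m.-tuple bool) : u = zeros m <-> bval u = 0.
Proof.
by rewrite -(bval_zeros m); split=> [->//|]; apply: bval_tuple_inj.
Qed.

(* Move the element [false :: w] to the end of the order [rank0]. *)
Lemma free_order m (W : pred (seq bool)) :
    (forall y z, size y = m -> size z = m -> W y -> W z -> y = z) ->
  exists h : {perm m.+1.-tuple bool},
    (forall y z : m.+1.-tuple bool,
       free_fin (W (behead z)) (cmp y z) <-> lex_succ (h y) (h z)) /\
    (forall w, size w = m -> W w -> forall u, h u = ones _ <-> val u = false :: w).
Proof.
move=> W_uniq.
have P0 := expn_gt0 2 m.
have [[w sw Ww]|noW] := EM (exists2 w, size w = m & W w); last first.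
  have [h hE] := rank_perm (@rank0_lt m) (@rank0_inj m).
  exists h; split=> [y z|w sw Ww]; last by case: noW; exists w.
  rewrite lex_succE !hE; case/tupleP: y => a y; case/tupleP: z => c z.
  have /negbTE -> : ~~ W (behead [tuple of c :: z]).
    by apply/negP => Wz; apply: noW; exists z => //; exact: size_tuple.
  rewrite cmp_cons ?size_tuple // /rank0 /=.
  by case: a; case: c => /=; split; lia.
pose r := 2 * bval w.
have rlt : r < 2 ^ m.+1 by have := bval_lt w; rewrite sw expnS /r; lia.
(* Rank [r] belongs to 0w: it is moved to the maximum, and the larger ranks close the gap. *)
pose R (u : m.+1.-tuple bool) :=
  if rank0 u == r then (2 ^ m.+1).-1 else if rank0 u < r then rank0 u else (rank0 u).-1.
have [u|u v|h hE] := @rank_perm m.+1 R.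
- have := rank0_lt u; rewrite /R; case: eqP => _; first by lia.
  by case: ifP; lia.
- have := rank0_lt u; have := rank0_lt v; rewrite /R => ltv ltu e.
  by apply: rank0_inj; move: e; do ![case: eqP|case: ifP]; lia.
exists h; split=> [y z|w' sw' Ww' u].
  rewrite lex_succE !hE /R; case/tupleP: y => a y; case/tupleP: z => c z.
  (* Uniqueness of the witness turns the test [W] into a comparison of values, leaving pure
     arithmetic. *)
  have -> : W (behead [tuple of c :: z]) = (bval z == bval w).
    rewrite /=; apply/idP/eqP => [Wz|/(@bval_inj z w) -> //]; last by rewrite size_tuple.
    by congr bval; apply: W_uniq; rewrite // size_tuple.
  have := bval_lt y; have := bval_lt z; have := bval_lt w.
  rewrite cmp_cons ?size_tuple // /rank0 /= /r expnS sw.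
  case: a; case: c => /=; do ![case: eqP|case: ifP]; split; lia.
rewrite eq_ones hE (W_uniq w' w) // {w' sw' Ww'}.
case/tupleP: u => a y; have := bval_lt y; have := bval_lt w.
rewrite /R /rank0 /= /r expnS size_tuple sw => ltw lty.
split=> [e|[-> ->]]; last by rewrite addn0 eqxx.
have [ea /bval_inj ey] : a = false /\ bval y = bval w.
  by move: e; case: a; do ![case: eqP|case: ifP] => /=; lia.
by rewrite ea ey // size_tuple.
Qed.

(* Rotate the order [rank0] so that [false :: w] comes last. *)
Lemma circ_order m (W : pred (seq bool)) :
    (forall y z, size y = m -> size z = m -> W y -> W z -> y = z) ->
  exists h : {perm m.+1.-tuple bool},
    (forall y z : m.+1.-tuple bool,
       circ_fin (cmp y z) <-> lex_succ (h y) (h z) \/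
                              (h y = ones _ /\ h z = zeros _)) /\
    (forall w, size w = m -> W w -> forall u, h u = ones _ <-> val u = false :: w).
Proof.
move=> W_uniq.
have P0 := expn_gt0 2 m.
(* Without a witness any rotation will do, and [r = 0] is taken. *)
have [r rlt hr] : exists2 r, r < 2 ^ m.+1 &
    forall w, size w = m -> W w -> r = 2 * bval w.
  have [[w sw Ww]|noW] := EM (exists2 w, size w = m & W w).
    exists (2 * bval w); first by have := bval_lt w; rewrite sw expnS; lia.
    by move=> w' sw' Ww'; rewrite (W_uniq w w').
  exists 0; first by rewrite expn_gt0.
  by move=> w sw Ww; case: noW; exists w.
(* This is [rank0 u - r.+1] modulo [2 ^ m.+1], so rank [r] becomes the maximum. *)
pose R (u : m.+1.-tuple bool) :=
  if rank0 u <= r then rank0 u + (2 ^ m.+1 - r.+1) else rank0 u - r.+1.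
have [u|u v|h hE] := @rank_perm m.+1 R.
- by have := rank0_lt u; rewrite /R; case: ifP; lia.
- have := rank0_lt u; have := rank0_lt v; rewrite /R => ltv ltu e.
  by apply: rank0_inj; move: e; do ![case: ifP]; lia.
exists h; split=> [y z|w sw Ww u].
  rewrite lex_succE eq_ones eq_zeros !hE /R.
  case/tupleP: y => a y; case/tupleP: z => c z.
  have := bval_lt y; have := bval_lt z.
  rewrite expnS in rlt *; rewrite cmp_cons ?size_tuple // /rank0 /=.
  case: a; case: c => /=; do ![case: ifP]; split; lia.
rewrite eq_ones hE /R (hr w) //.
case/tupleP: u => a y; have := bval_lt y; have := bval_lt w.
rewrite /rank0 /= expnS size_tuple sw => ltw lty.
split=> [e|[-> ->]]; last by rewrite addn0 leqnn; lia.
have [ea /bval_inj ey] : a = false /\ bval y = bval w.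
  by move: e; case: a; do ![case: ifP] => /=; lia.
by rewrite ea ey // size_tuple.
Qed.

(** * Complexity classes *)

Lemma deterministic_guesses (M : machine) args g (d : config M) :
  deterministic M -> path_to args g d -> g = [::].
Proof.
move=> dM [[n R] _]; elim: R => // c a b m h d' e.
by case: (dM _ _ _ e).
Qed.

Lemma deterministic_total (M : machine) x :
    deterministic M -> polytime M 1 ->
  exists d : config M, path_to [:: x] [::] d.
Proof.
move=> dM [q hq].
have [g [_ [_ [d [_ p _]]]]] := total_path [::] (hq [:: x] erefl).
by exists d; rewrite -(deterministic_guesses dM p).
Qed.

Lemma accepting_guesses (M : machine) x g :
  deterministic M -> accepting_path M [:: x] g -> g = [::].
Proof. by move=> dM [d p _]; exact: deterministic_guesses p. Qed.

Lemma deterministic_take (M : machine) x g : deterministic M ->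
  (exists k, accepting_path M [:: x] (take k g)) <-> accepting_path M [:: x] [::].
Proof.
move=> dM; split=> [[k /[dup] /(accepting_guesses dM) -> //]|ac].
by exists 0; rewrite take0.
Qed.

(** The machine for [L2] is replayed after the one for [L1] accepts; being deterministic, it takes
    no bit from the output offered as guesses. *)
Lemma classP_setI L1 L2 : classP L1 -> classP L2 -> classP (fun x => L1 x /\ L2 x).
Proof.
move=> [A [dA pA hA]] [B [dB pB hB]].
have [M [pM dM hM]] := guided (@accepting A) true pA pB.
exists M; split=> //; first exact: dM.
move=> x; rewrite hM hA hB; split=> [[[d p ac] b]|[d [p ac]]].
  by exists d; rewrite (propext (deterministic_take _ _ dB)).
by rewrite (propext (deterministic_take _ _ dB)) => h; split; [exists d|apply/h].
Qed.

(** The first run of [A] serves merely as a halting computation; the replay of [A] with negative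
    polarity inverts the verdict. *)
Lemma classP_setC L : classP L -> classP (fun x => ~ L x).
Proof.
move=> [A [dA pA hA]].
have [M [pM dM hM]] := guided (T := A) (fun=> true) false pA pA.
exists M; split=> //; first exact: dM.
move=> x; rewrite hM hA; split=> [nA|[d [_ _]]].
  have [d p] := deterministic_total x dA pA; exists d; split=> //.
  by rewrite (propext (deterministic_take _ _ dA)).
by rewrite (propext (deterministic_take _ _ dA)) => h /h.
Qed.

Lemma FPt_total F : FPt F -> exists M, [/\ deterministic M, polytime M 1 &
  forall x (d : config M), path_to [:: x] [::] d -> output d = F x].
Proof.
move=> [M [dM pM hM]]; exists M; split=> // x d p; case: (hM x) => d' p' <-.
by case: (path_to_unique (r := [::]) (r' := [::]) p p' erefl) => _ ->.
Qed.

(** All paths of a balanced machine have the same length, so the only prefix of [y] that can be a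
    path is [y] itself. *)
Lemma balanced_take p (N : machine) x y : balanced p N -> size y = p.[size x]%R ->
  (exists k, accepting_path N [:: x] (take k y)) <-> accepting_path N [:: x] y.
Proof.
move=> bN sy; split=> [[k /[dup] ac [d pd _]]|ac]; last first.
  by exists (size y); rewrite take_size.
have /bN : is_path N [:: x] (take k y) by exists d.
rewrite -sy => st; move: ac; rewrite -{2}[y](cat_take_drop k).
have /size0nil -> : size (drop k y) = 0.
  by have := congr1 size (cat_take_drop k y); rewrite size_cat; lia.
by rewrite cats0.
Qed.

Lemma classP_replay p (N : machine) F :
    NPTM N -> balanced p N -> FPt F -> (forall x, size (F x) = p.[size x]%R) ->
  classP (fun x => accepting_path N [:: x] (F x)).
Proof.
move=> pN bN /FPt_total [T [dT pT hT]] sF.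
have [M [pM dM hM]] := guided (T := T) (fun=> true) true pT pN.
exists M; split=> //; first exact: dM.
move=> x; rewrite hM; split=> [ac|[d [p1 _ h]]].
  have [d p1] := deterministic_total x dT pT; exists d; split=> //.
  by rewrite (hT _ _ p1) (propext (balanced_take bN (sF x))).
by apply/(balanced_take bN (sF x)); rewrite -(hT _ _ p1); apply/h.
Qed.

Lemma classP_sub_UP L : classP L -> classUP L.
Proof.
move=> [M [dM pM hM]]; exists M; split=> //.
  by move=> x g g' /(accepting_guesses dM) -> /(accepting_guesses dM) ->.
move=> x; rewrite hM; split=> [ac|[g /[dup] /(accepting_guesses dM) -> //]].
by exists [::].
Qed.

(** * From a UP language to the hard instance *)

Lemma padded_witnessP (N : machine) (q : {poly nat}) L :
    (forall x n g d, run (init N [:: x]) n g d -> n <= q.[size x]%R) ->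
    at_most_one_accepting_path N ->
    (forall x, L x <-> exists g, accepting_path N [:: x] g) ->
  (forall x, L x <-> exists2 y, size y = q.[size x]%R & padded_witness N x y) /\
  (forall x y z, size y = size z ->
     padded_witness N x y -> padded_witness N x z -> y = z).
Proof.
move=> time_N uN hN; split=> [x|x y z syz].
  rewrite hN; split=> [[g ac]|[y _ [k _ [ac _]]]]; last by exists (take k y).
  (* The time bound also bounds the number of guesses, so there is room for the padding. *)
  have sg : size g <= q.[size x]%R.
    case: (ac) => d [[n R] _] _; have le := trun_size ((runE _ _ _ _).1 R).
    exact: leq_trans le (time_N _ _ _ _ R).
  exists (g ++ nseq (q.[size x]%R - size g) false).
    by rewrite size_cat size_nseq subnKC.
  exists (size g); first by rewrite size_cat leq_addr.
  by rewrite take_size_cat // drop_size_cat // all_nseq /= orbT.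
move=> [k lek [ack zk]] [l lel [acl zl]].
have et := uN _ _ _ ack acl.
have ekl : k = l by have := congr1 size et; rewrite !size_takel.
have zeros_eq s : all negb s -> s = nseq (size s) false.
  by elim: s => //= -[] //= s IH /IH {1}->.
rewrite -(cat_take_drop k y) -(cat_take_drop l z) -et (zeros_eq _ zk) (zeros_eq _ zl).
by rewrite !size_drop syz ekl.
Qed.

(** One machine serves both orders: outside [L] there is no padded witness and nothing is rejected;
    inside [L] the only rejected path is 0w, which both orders place last. *)
Lemma UP_instance L : classUP L -> exists (p : {poly nat}) (M : machine)
    (prec_f prec_c : seq bool -> seq bool -> seq bool -> Prop)
    (hf hc : bijections p),
  [/\ NPTM M /\ balanced p M,
      polytime_pred3 prec_f /\ adjacency hf prec_f,
      polytime_pred3 prec_c /\ circular_adjacency hc prec_c &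
      forall x, (~ L x /\ forall u : (p.[size x]%R).-tuple bool,
                   accepting_path M [:: x] u) \/
                (L x /\ forall u : (p.[size x]%R).-tuple bool,
                   (accepting_path M [:: x] u <-> hf x u <> ones _) /\
                   (accepting_path M [:: x] u <-> hc x u <> ones _))].
Proof.
move=> [N [[q hq] uN hN]].
have time_N x n g d : run (init N [:: x]) n g d -> n <= q.[size x]%R.
  by move/(hq [:: x] erefl); rewrite /= addn0.
have [hL W_uniq] := padded_witnessP time_N uN hN.
pose p := (q + 1)%R : {poly nat}.
have pE x : p.[size x]%R = q.[size x]%R.+1.
  by rewrite /p hornerD hornerC; exact: addn1.
have [M [pM bM hM]] := balanced_machine p time_N.
pose W x y := `[< padded_witness N x y >].
have W_uniq' x y z : size y = q.[size x]%R -> size z = q.[size x]%R ->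
    W x y -> W x z -> y = z.
  by move=> sy sz /asboolP Wy /asboolP; apply: W_uniq Wy; rewrite sy.
have ordf x : exists h : {perm (p.[size x]%R).-tuple bool},
    (forall y z : (p.[size x]%R).-tuple bool,
       free_fin (W x (behead z)) (cmp y z) <-> lex_succ (h y) (h z)) /\
    (forall w, size w = q.[size x]%R -> W x w ->
       forall u, h u = ones _ <-> val u = false :: w).
  by rewrite pE; apply: free_order; exact: W_uniq'.
have ordc x : exists h : {perm (p.[size x]%R).-tuple bool},
    (forall y z : (p.[size x]%R).-tuple bool,
       circ_fin (cmp y z) <-> lex_succ (h y) (h z) \/
                              (h y = ones _ /\ h z = zeros _)) /\
    (forall w, size w = q.[size x]%R -> W x w ->
       forall u, h u = ones _ <-> val u = false :: w).
  by rewrite pE; apply: circ_order; exact: W_uniq'.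
(* The orders depend on the unknown witness and are picked by choice for each [x]; only their
   adjacency has to be computable. *)
pose hf : bijections p := fun x => sval (cid (ordf x)).
pose hc : bijections p := fun x => sval (cid (ordc x)).
exists p, M, (fun x y z => free_fin (W x (behead z)) (cmp y z)),
  (fun _ y z => circ_fin (cmp y z)), hf, hc; split.
- by [].
- split; first exact: free_prec_polytime time_N.
  by move=> x y z; rewrite /hf; case: cid => h [].
- split; first exact: circ_prec_polytime.
  by move=> x y z; rewrite /hc; case: cid => h [].
move=> x; have [Lx|nLx] := EM (L x); [right|left]; split=> // u.
  have [w sw /asboolP Ww] := (hL x).1 Lx.
  have bad : bad_path N x u <-> val u = false :: w.
    split=> [[y eu Wy]|->]; last by exists w => //; apply/asboolP.
    rewrite [val u]eu; congr (_ :: _); apply: (W_uniq x) => //; last exact/asboolP.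
    by have := size_tuple u; rewrite eu pE /= => -[->].
  have hfE : hf x u = ones _ <-> val u = false :: w.
    by rewrite /hf; case: (cid _) => h [? H]; exact: (H w sw Ww).
  have hcE : hc x u = ones _ <-> val u = false :: w.
    by rewrite /hc; case: (cid _) => h [? H]; exact: (H w sw Ww).
  by rewrite hfE hcE (hM x u (size_tuple u)) bad.
apply/(hM x u (size_tuple u)) => -[y eu Wy]; apply/nLx/hL; exists y => //.
by have := size_tuple u; rewrite eu pE /= => -[->].
Qed.

(** * What the hard instance forces *)

Section Consequences.
Variables (p : {poly nat}) (M : machine) (L : language).
Implicit Type h : bijections p.

Definition hard_for h : Prop :=
  forall x, (~ L x /\ forall u : (p.[size x]%R).-tuple bool,
               accepting_path M [:: x] u) \/
            (L x /\ forall u : (p.[size x]%R).-tuple bool,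
               accepting_path M [:: x] u <-> h x u <> ones _).

Lemma hard_cluster h : hard_for h ->
  cluster h M (fun x => #|acc p M x|).
Proof.
move=> H x nz; case: (H x) => -[Lx acx].
  exists ((h x)^-1%g (zeros _)), ((h x)^-1%g (ones _)); apply/setP => w.
  rewrite !inE !permKV !lex_leE bval_zeros bval_ones.
  have -> : `[< accepting_path M [:: x] w >] by apply/asboolP.
  have := bval_lt (h x w); rewrite size_tuple /=; lia.
(* In the language, the interval runs from the bottom to [c], the string just below the top. *)
have [c ec] : exists c : (p.[size x]%R).-tuple bool,
    bval c = (2 ^ p.[size x]%R).-2.
  by apply: bval_surj; have := expn_gt0 2 p.[size x]%R; lia.
(* A single string would be the rejected top, contradicting a nonzero count; so [.-2] is a genuine
   predecessor of the maximal value. *)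
have {}nz : 1 < 2 ^ p.[size x]%R.
  rewrite ltnNge; apply/negP => le1; case: nz; apply: eq_card0 => u; rewrite inE.
  apply/asboolP => /acx; apply; apply/eq_ones.
  have := bval_lt (h x u); rewrite size_tuple; move: le1.
  by move: (2 ^ _) (bval _) => P k; lia.
exists ((h x)^-1%g (zeros _)), ((h x)^-1%g c); apply/setP => w.
rewrite !inE !permKV !lex_leE bval_zeros ec leq0n /=.
have := bval_lt (h x w); rewrite size_tuple => lt.
apply/asboolP/idP => [/acx|le]; last first.
  by apply/acx => /eq_ones; move: nz lt le; move: (2 ^ _) (bval _) => P k; lia.
by rewrite eq_ones; move: nz lt; move: (2 ^ _) (bval _) => P k; lia.
Qed.

Lemma hard_top h x : hard_for h ->
  L x <-> ~ accepting_path M [:: x] (top_fun h x).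
Proof.
move=> H; rewrite /top_fun; case: (H x) => -[Lx acx].
  by split=> // ac; case: ac; apply: acx.
split=> // _ /acx; apply; exact: permKV.
Qed.

(** Equal counts carry information from [M] to [M']. Outside [L] all paths of [M] accept, hence all
    of [M']. If [M'] accepts both of its ends, its interval is everything, so all paths of [M]
    accept, including the top, which is impossible inside [L]. *)
Lemma CLU_classP h : hard_for h -> CLU p (fun x => #|acc p M x|) -> classP L.
Proof.
move=> H [M' [b [t [prec [h' [[pM' bM'] [fb ft _] ends _ [cl cnt]]]]]]].
have sb x : size (b x) = p.[size x]%R.
  by case: (ends x) => -[y <- _] _; exact: size_tuple.
have st x : size (t x) = p.[size x]%R.
  by case: (ends x) => _ [y <- _]; exact: size_tuple.
have := classP_setC (classP_setI (classP_replay pM' bM' fb sb)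
  (classP_replay pM' bM' ft st)).
suff -> : (fun x => ~ (accepting_path M' [:: x] (b x) /\
  accepting_path M' [:: x] (t x))) = L by [].
apply/predeqP => x.
have inacc (N : machine) (y : (p.[size x]%R).-tuple bool) :
    y \in acc p N x <-> accepting_path N [:: x] y.
  by rewrite inE; split=> /asboolP.
case: (ends x) => -[yb eb hb] [yt et ht]; rewrite -eb -et -!inacc.
have := cnt x; case: (H x) => -[Lx acx] card_eq; split=> //.
- case; have -> : acc p M' x = [set: _]%SET.
    have eM : acc p M x = [set: _]%SET.
      by apply/setP => u; rewrite !inE; apply/asboolP/acx.
    by apply/eqP; rewrite eqEcard finset.subsetT /= -card_eq eM.
  by rewrite !inE.
- move=> _ [ib it].
  (* The cluster condition is available because the accepted path [b x] makes the count nonzero. *)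
  have [l [u eacc]] : exists l u : (p.[size x]%R).-tuple bool, acc p M' x =
      [set w | lex_le (h' x l) (h' x w) && lex_le (h' x w) (h' x u)]%SET.
    by apply: cl => f0; move: ib; rewrite card_eq in f0; rewrite (card0_eq f0).
  have full : acc p M' x = [set: _]%SET.
    apply/setP => w; rewrite eacc !inE; move: ib it; rewrite eacc !inE hb ht.
    rewrite !lex_leE bval_zeros bval_ones.
    have := bval_lt (h' x w); rewrite size_tuple => lt /andP[l0 _] /andP[_ ltu].
    by rewrite (leq_trans l0) // (leq_trans _ ltu) // -ltnS (leq_trans lt) ?leqSpred.
  pose top : (p.[size x]%R).-tuple bool := (h x)^-1%g (ones _).
  have : top \in acc p M x.
    suff -> : acc p M x = [set: _]%SET by rewrite inE.
    by apply/eqP; rewrite eqEcard finset.subsetT /= card_eq full.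
  by move=> /inacc /acx; apply; exact: permKV.
Qed.

End Consequences.

Theorem theorem5p7 :
  [/\ (forall (p : {poly nat}) (M : machine)
         (prec : seq bool -> seq bool -> seq bool -> Prop)
         (f : seq bool -> nat),
         CLUcircular_witness p M prec f -> CLU p f) ->
      classP = classUP,
      (forall (p : {poly nat}) (M : machine)
         (prec : seq bool -> seq bool -> seq bool -> Prop)
         (f : seq bool -> nat),
         CLUfree_witness p M prec f -> CLU p f) ->
      classP = classUP,
      (forall (p : {poly nat}) (M : machine)
         (prec : seq bool -> seq bool -> seq bool -> Prop)
         (f : seq bool -> nat) (h : bijections p),
         CLUfree_with M prec f h -> UPSVt (top_fun h) /\ UPSVt (bot_fun h)) ->
      classUP = classcoUP
    & (forall (p : {poly nat}) (M : machine)
         (prec : seq bool -> seq bool -> seq bool -> Prop)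
         (f : seq bool -> nat) (h : bijections p),
         CLUfree_with M prec f h -> FPt (top_fun h) /\ FPt (bot_fun h)) ->
      classP = classUP].
Proof.
have P_UP : (forall L, classUP L -> classP L) -> classP = classUP.
  by move=> H; apply/predeqP => L; split; [exact: classP_sub_UP|exact: H].
have hard_f p M L (hf hc : bijections p) : (forall x,
    (~ L x /\ forall u : (p.[size x]%R).-tuple bool, accepting_path M [:: x] u) \/
    (L x /\ forall u : (p.[size x]%R).-tuple bool,
       (accepting_path M [:: x] u <-> hf x u <> ones _) /\
       (accepting_path M [:: x] u <-> hc x u <> ones _))) ->
  hard_for M L hf /\ hard_for M L hc.
  by move=> H; split=> x; case: (H x) => [?|[Lx acx]];
    (by left) || by right; split=> // u; case: (acx u).
split=> [H|H|H|H].
- apply: P_UP => L /UP_instance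
    [p [M [precf [precc [hf [hc [pM _ [pc adj] /hard_f [_ hd]]]]]]]].
  apply: (CLU_classP hd); apply: (H p M precc); exists hc; split=> //.
  exact: hard_cluster hd.
- apply: P_UP => L /UP_instance
    [p [M [precf [precc [hf [hc [pM [pf adj] _ /hard_f [hd _]]]]]]]].
  apply: (CLU_classP hd); apply: (H p M precf); exists hf; split=> //.
  exact: hard_cluster hd.
(* Complementation is an involution, so closure of UP under complement gives both inclusions. *)
- suff UPC L : classUP L -> classUP (~` L)%classic.
    apply/predeqP => L; split=> [/UPC//|/UPC]; by rewrite setCK.
  move=> /UP_instance [p [M [precf [precc [hf [hc [pM [pf adj] _ /hard_f [hd _]]]]]]]].
  have [[T [pT uT dT oT]] _] := H p M precf _ hf
    (And5 pM pf adj (hard_cluster hd) (fun=> erefl)).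
  (* The unique accepting path of [T] outputs the top, on which [M] is replayed; acceptance then
     means that [x] is outside [L]. *)
  have [A [pA _ hA]] := guided (@accepting T) true pT pM.1.
  exists A; split=> // [x g g'|x].
    by rewrite !hA => -[d [pd ad _]] [d' [pd' ad' _]]; apply: (uT x); [exists d|exists d'].
  have rep (d : config T) g : path_to [:: x] g d -> accepting (cstate d) ->
      (exists k, accepting_path M [:: x] (take k (output d))) <-> (~` L)%classic x.
    move=> pd ad; have [<-] := oT _ _ _ pd ad.
    rewrite (balanced_take pM.2) ?size_tuple // /setC /= (hard_top x hd).
    by split=> [ac /(_ ac)//|/contrapT].
  split=> [nL|[g /hA [d [pd ad]]]].
    have [|g [d pd ad]] := (dT x).2; first by [].
    by exists g; apply/hA; exists d; rewrite (propext (rep _ _ pd ad)).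
  by rewrite (propext (rep _ _ pd ad)) => h; exact/h.
- apply: P_UP => L /UP_instance
    [p [M [precf [precc [hf [hc [pM [pf adj] _ /hard_f [hd _]]]]]]]].
  have [top_FP _] := H p M precf _ hf
    (And5 pM pf adj (hard_cluster hd) (fun=> erefl)).
  (* Evaluating [M] at the computed top decides the complement of [L]. *)
  have := classP_setC (classP_replay pM.1 pM.2 top_FP (fun x => size_tuple _)).
  suff -> : (fun x => ~ accepting_path M [:: x] (top_fun hf x)) = L by [].
  by apply/predeqP => x; split=> /(hard_top x hd).
Qed.
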